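(* Let $0=\epsilon_1<\epsilon_2<\cdots<\epsilon_\kappa<1$ be the elements of the underlying set of the multiset $W_{L/K}$, ordered by increasing size. For $1\le i\le\kappa$ denote $m_i=f_{\epsilon_i}$, so that $W_{L/K}=\{\epsilon_i^{m_i}\mid 1\le i\le\kappa\}$. Let $\mathbb{B}=(\alpha_1,\dots,\alpha_n)\in B^n$ be an orthonormal basis of $L/K$. Then $\mathbb{B}'=(\alpha'_1,\dots,\alpha'_n)\in L^n$ is an orthonormal basis of $L/K$ if and only if the transition matrix $T$ from $\mathbb{B}$ to $\mathbb{B}'$, determined by $$\begin{pmatrix}\alpha'_1\\ \vdots\\ \alpha'_n\end{pmatrix}=T\begin{pmatrix}\alpha_1\\ \vdots\\ \alpha_n\end{pmatrix},$$ belongs to the orthonormal group $O(m_1,\dots,m_\kappa,A)$.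
   Context: $v\colon K\to\mathbb{Z}\cup\{\infty\}$ is a (normalized) discrete valuation on a field $K$, with valuation ring $A$, uniformizer $\pi\in A$, maximal ideal $\mathfrak{m}=\pi A$ and residue field $k=A/\mathfrak{m}$. $L=K(\theta)$ is a finite extension of $K$ of degree $n>1$, where $\theta$ is a root of a monic irreducible polynomial $f\in A[x]$ of degree $n$. $B\subset L$ is the integral closure of $A$ in $L$, assumed to be finitely generated as an $A$-module (hence free of rank $n$). An integral basis of $L/K$ is an $A$-basis of $B$. $w_1,\dots,w_t$ are the valuations on $L$ extending $v$; for each $i$, $k_i$ is the residue field of $w_i$, $f_i=[k_i\colon k]$, and $e_i=e(w_i/v)$ is the ramification index, so that $w_i(L^* )=e_i^{-1}\mathbb{Z}$. The function $w\colon L\to\mathbb{Q}\cup\{\infty\}$ is defined by $w(\alpha)=\min\{w_i(\alpha)\mid 1\le i\le t\}$. A subset (or family) $\{\alpha_1,\dots,\alpha_d\}\subset L^*$ is called reduced if $w\left(\sum_{j=1}^d a_j\alpha_j\right)=\min\{w(a_j\alpha_j)\mid 1\le j\le d\}$ for all $a_1,\dots,a_d\in K$. An orthonormal basis of $L/K$ is a reduced integral basis $(\alpha_1,\dots,\alpha_n)\in B^n$ ordered by increasing $w$-values: $w(\alpha_1)\le\cdots\le w(\alpha_n)$. $W_{L/K}$ is the multiset with underlying set $E=w(L^* )\cap[0,1)$ in which each $\delta\in E$ has multiplicity $f_\delta=\sum_{i\in I_\delta}f_i$, where $I_\delta=\{1\le i\le t\mid\delta\in e_i^{-1}\mathbb{Z}\}$.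 Its total cardinality is $n$, so $n=m_1+\cdots+m_\kappa$. For a partition $n=m_1+\cdots+m_\kappa$ into positive integers, decompose any $T\in A^{n\times n}$ into blocks $T=(T_{ij})$ with $T_{ij}\in A^{m_i\times m_j}$, $1\le i,j\le\kappa$. The orthonormal group $O(m_1,\dots,m_\kappa,A)$ is the subgroup of $\mathrm{GL}_n(A)$ formed by all $T\in A^{n\times n}$ such that (1) $T_{ii}\in\mathrm{GL}_{m_i}(A)$ for $1\le i\le\kappa$, and (2) $T_{ij}\in\mathfrak{m}^{m_i\times m_j}$ (all entries in $\mathfrak{m}$) for all $i>j$. *)

(* Defs.v *)
From HB Require Import structures.
From mathcomp Require Import all_boot all_order all_algebra all_field.
From mathcomp Require Import constructive_ereal.

Set Implicit Arguments.
Unset Strict Implicit.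
Unset Printing Implicit Defensive.

Import Order.TTheory GRing.Theory Num.Theory.

Local Open Scope ring_scope.
Local Open Scope quotient_scope.

(* Values lie in R + {oo}, rendered in [\bar R]; [val_fin] excludes -oo and
   says that only 0 has infinite value. *)
Record valuation (R : realDomainType) (F : fieldType) := Valuation {
  vfun :> F -> \bar R;
  val_zero : vfun 0 = +oo%E;
  val_fin : forall x, x != 0 -> vfun x \is a fin_num;
  val_mul : forall x y, vfun (x * y) = (vfun x + vfun y)%E;
  val_add : forall x y, (Order.min (vfun x) (vfun y) <= vfun (x + y)%R)%E
}.

Definition valring (R : realDomainType) (F : fieldType) (v : valuation R F) :=
  [pred x : F | (0 <= v x)%E].

Section ValuationRing.
Variables (R : realDomainType) (F : fieldType) (v : valuation R F).

Lemma val_real x : x != 0 -> exists r, v x = r%:E%E.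
Proof. by move=> x0; apply/EFin_fin_numP; apply: val_fin. Qed.

Lemma val_one : v 1 = 0%E.
Proof.
have [r vr] := val_real (oner_neq0 F).
have := val_mul v 1 1; rewrite mulr1 vr -EFinD => -[] /esym/eqP.
by rewrite -subr_eq0 addrK => /eqP ->.
Qed.

Lemma val_opp x : v (- x) = v x.
Proof.
have N1 : - 1 != 0 :> F by rewrite oppr_eq0 oner_neq0.
have [r vr] := val_real N1.
have r0 : r = 0.
  have := val_mul v (- 1) (- 1); rewrite mulrNN mulr1 val_one vr -EFinD.
  by case=> /esym/eqP; rewrite -mulr2n mulrn_eq0 => /eqP.
by rewrite -mulN1r val_mul vr r0 add0e.
Qed.

Lemma val_inv x : x != 0 -> (v x + v (x^-1)%R)%E = 0%E.
Proof. by move=> x0; rewrite -val_mul mulfV // val_one. Qed.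

Lemma valring_subring : subring_closed (valring v).
Proof.
split=> [|x y|x y]; rewrite !inE.
- by rewrite val_one.
- move=> vx vy; apply: le_trans (val_add v x (- y)).
  by rewrite val_opp le_min vx vy.
- by move=> vx vy; rewrite val_mul adde_ge0.
Qed.

HB.instance Definition _ :=
  GRing.isSubringClosed.Build F (valring v) valring_subring.

Record valRing := ValRing { valRing_val : F; _ : valRing_val \in valring v }.

HB.instance Definition _ := [isSub for valRing_val].
HB.instance Definition _ := [Choice of valRing by <:].
HB.instance Definition _ := [SubChoice_isSubComNzRing of valRing by <:].

Definition valRing_unit : pred valRing := fun a => v (val a) == 0%E.
Definition valRing_inv (a : valRing) : valRing := insubd a (val a)^-1.

Lemma valRing_mulV : {in valRing_unit, left_inverse 1 valRing_inv *%R}.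
Proof.
move=> a /eqP va; apply: val_inj.
have a0 : val a != 0 by apply/eqP => a0; rewrite a0 val_zero in va.
have Va : v (val a)^-1 = 0%E by have := val_inv a0; rewrite va add0e.
by rewrite rmorphM rmorph1 /= val_insubd inE Va lexx mulVf.
Qed.

Lemma valRing_unitPl (a b : valRing) : b * a = 1 -> valRing_unit a.
Proof.
move=> /(congr1 val); rewrite rmorphM rmorph1 /= => ab1.
have := val_mul v (val b) (val a); rewrite ab1 val_one => /esym/eqP.
have := valP a; have := valP b; rewrite !inE => vb va.
by rewrite padde_eq0 // => /andP[].
Qed.

Lemma valRing_inv_out : {in [predC valRing_unit], valRing_inv =1 id}.
Proof.
move=> a; rewrite inE /= => aU; apply: val_inj; rewrite val_insubd inE.
case: ifP => // Va; have [->|a0] := eqVneq (val a) 0; first by rewrite invr0.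
move: aU; have := valP a; rewrite inE => va.
have /eqP := val_inv a0; rewrite padde_eq0 // => /andP[va0 _].
by rewrite /in_mem /= /valRing_unit va0.
Qed.

HB.instance Definition _ := GRing.ComNzRing_hasMulInverse.Build valRing
  valRing_mulV valRing_unitPl valRing_inv_out.

Definition maxideal : {pred valRing} := fun a => (0 < v (val a))%E.

Lemma maxidealE a : (a \in maxideal) = (a \isn't a GRing.unit).
Proof.
have := valP a; rewrite inE => va.
by rewrite /in_mem /= /maxideal lt_def va andbT.
Qed.

Lemma maxideal_idealr : idealr_closed maxideal.
Proof.
split.
- by rewrite /in_mem /= /maxideal rmorph0 val_zero lt0y.
- by rewrite maxidealE unitr1.
move=> a x y; rewrite /in_mem /= /maxideal rmorphD rmorphM /= => vx vy.
apply: lt_le_trans (val_add v _ _); rewrite lt_min vy andbT val_mul.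
by apply: lt_le_trans vx _; apply: leeDr; have := valP a; rewrite inE.
Qed.

HB.instance Definition _ := isIdealr.Build valRing maxideal maxideal_idealr.

Definition resField := {ideal_quot maxideal}.
HB.instance Definition _ := GRing.ComNzRing.on resField.
HB.instance Definition _ := NzRingQuotient.on resField.

Lemma pi_res_eq0 (a : valRing) : (\pi_resField a == 0) = (a \in maxideal).
Proof. by rewrite -[a in RHS]subr0 Quotient.idealrBE -[\pi_(_) 0]/(\pi_resField 0) rmorph0. Qed.

Definition res_inv (q : resField) : resField := \pi_resField (repr q)^-1.

Lemma res_mulV q : q != 0 -> res_inv q * q = 1.
Proof.
rewrite -{1 3}[q]reprK pi_res_eq0 maxidealE negbK => qU.
by rewrite -rmorphM mulVr // rmorph1.
Qed.

Lemma res_inv0 : res_inv 0 = 0.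
Proof.
have m0 : repr (0 : resField) \in maxideal by rewrite -pi_res_eq0 reprK.
apply/eqP; rewrite pi_res_eq0.
by rewrite invr_out // -maxidealE.
Qed.

HB.instance Definition _ :=
  GRing.ComNzRing_isField.Build resField res_mulV res_inv0.

End ValuationRing.

Arguments maxideal {R F} v.
Arguments resField {R F} v.

Section Extension.
Variables (K : fieldType) (v : valuation int K) (L : fieldExtType K).

Definition extends_val (w : valuation rat L) :=
  forall a : K, w a%:A = er_map intr (v a).

Section OneExtension.
Variables (w : valuation rat L) (vw : extends_val w).

Lemma extends_valring (a : valRing v) : (val a)%:A \in valring w.
Proof.
by have := valP a; rewrite !inE vw; case: (v _) => //= r; rewrite !lee_fin ler0z.
Qed.

Definition valRing_incl (a : valRing v) : valRing w := ValRing (extends_valring a).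

Definition resmap (x : resField v) : resField w :=
  \pi_(resField w) (valRing_incl (repr x)).

Lemma resmap_pi (a : valRing v) :
  resmap (\pi_(resField v) a) = \pi_(resField w) (valRing_incl a).
Proof.
apply/eqP; rewrite /resmap -subr_eq0 -rmorphB pi_res_eq0.
set b := repr _; have : b - a \in maxideal v by rewrite -pi_res_eq0 rmorphB /= reprK subrr.
rewrite /in_mem /= /maxideal !rmorphB /= -scalerBl vw.
by case: (v _) => //= r; rewrite !lte_fin ltr0z.
Qed.

(* [k_w : k] = d *)
Definition residue_degree (d : nat) := exists b : 'I_d -> resField w,
  forall y : resField w, exists! c : 'rV[resField v]_d,
    y = \sum_j resmap (c 0 j) * b j.

(* (w(L^* ) : v(K^* )) = d, given by a system of d coset representatives *)
Definition ramification_index (d : nat) := exists r : 'I_d -> rat,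
  (forall j, exists2 x : L, x != 0 & w x = (r j)%:E%E) /\
  (forall x : L, x != 0 -> exists! j, exists2 a : K, a != 0 &
     w x = ((r j)%:E + er_map intr (v a))%E).

End OneExtension.

Definition valRing_inL (a : valRing v) : L := (val a)%:A.

Definition int_closure (x : L) : Prop := integralOver valRing_inL x.

Definition fg_int_closure := exists (d : nat) (s : 'I_d -> L),
  (forall i, int_closure (s i)) /\
  (forall x, int_closure x ->
     exists a : 'I_d -> valRing v, x = \sum_i valRing_inL (a i) * s i).

Definition integral_basis n (alpha : 'cV[L]_n) :=
  (forall i, int_closure (alpha i 0)) /\
  (forall x, int_closure x ->
     exists! a : 'rV[valRing v]_n, x = \sum_i valRing_inL (a 0 i) * alpha i 0).

Section MinVal.
Variables (t : nat) (w : 'I_t -> valuation rat L).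

(* w_0, ..., w_(t-1) are the valuations on L extending v, each listed once *)
Definition all_extensions :=
  [/\ forall i, extends_val (w i),
      forall i j, w i =1 w j -> i = j &
      forall u : valuation rat L, extends_val u -> exists i, u =1 w i].

Definition minval (x : L) : \bar rat := \big[Order.min/+oo%E]_(i < t) w i x.

Definition reduced n (alpha : 'cV[L]_n) :=
  (forall i, alpha i 0 != 0) /\
  (forall a : 'I_n -> K, minval (\sum_i a i *: alpha i 0) =
     \big[Order.min/+oo%E]_i minval (a i *: alpha i 0)).

Definition orthonormal_basis n (alpha : 'cV[L]_n) :=
  [/\ reduced alpha, integral_basis alpha &
      forall i j : 'I_n, (i <= j)%N ->
        (minval (alpha i 0%R) <= minval (alpha j 0%R))%E].

Definition W_support (delta : rat) :=
  0 <= delta < 1 /\ exists2 x : L, x != 0 & minval x = delta%:E%E.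

(* The index condition says that delta lies in (e i)^-1 Z. *)
Definition W_mult (e f : 'I_t -> nat) (delta : rat) : nat :=
  \sum_(i < t | delta * (e i)%:R \is a Num.int) f i.

End MinVal.

End Extension.

Section OrthonormalGroup.
Variables (R : realDomainType) (F : fieldType) (v : valuation R F).

Definition orthonormal_group kappa (m : 'I_kappa -> nat)
    (T : 'M[valRing v]_(\sum_i m i)) :=
  (forall i, submxblock T i i \in unitmx) /\
  (forall i j : 'I_kappa, (j < i)%N ->
     forall p q, submxblock T i j p q \in maxideal v).

(* Membership of a matrix over F indexed by 'I_n, for a partition
   n = m_1 + ... + m_kappa. *)
Definition in_orthonormal_group n kappa (m : 'I_kappa -> nat) (T : 'M[F]_n) :=
  exists (mn : (\sum_i m i)%N = n) (T0 : 'M[valRing v]_(\sum_i m i)),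
    T = castmx (mn, mn) (map_mx val T0) /\ orthonormal_group T0.

End OrthonormalGroup.

(* Main.v *)
Require Import Defs.
From HB Require Import structures.
From mathcomp Require Import all_boot all_order all_algebra all_field.
From mathcomp Require Import constructive_ereal.
From mathcomp Require Import boolp classical_sets.
From mathcomp Require Import zify ring lra.

Set Implicit Arguments.
Unset Strict Implicit.
Unset Printing Implicit Defensive.

Import Order.TTheory GRing.Theory Num.Theory.
Local Open Scope ring_scope.

(** The values of an orthonormal basis are forced: they lie in [0, 1), and for
    every [r] there the number of basis vectors of value [r] is the dimension
    over the residue field of [K] of the graded piece [{w >= r} / {w > r}].
    By weak approximation for the distinct valuations [w_i], this piece is the
    product of the graded pieces of the [w_i], each of which is zero or a line
    over the residue field of [w_i]; so its dimension is the multiplicity of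
    [r] in [W_(L/K)] ([reduced_value_count]). As bases are listed by increasing
    value, any orthonormal basis takes the value [eps_i] exactly on the [i]-th
    block of indices ([values_block]).

    Once the values are known, everything is read off from reducedness, in the
    form [w (\sum_p c_p alpha_p) = min_p (v c_p + eps_(block of p))].
    If [alpha' = T alpha] is orthonormal, comparing the value of [alpha'_s] with
    this formula puts the entries of [T] in [A], and those below the diagonal
    blocks in the maximal ideal ([transition_entries]); the inverse transition
    matrix has the same shape, so modulo the maximal ideal the diagonal blocks
    of the two matrices are inverse to each other
    ([block_triangular_unit]). Conversely, let [T] be in the orthonormal group
    and [k + eps_i] be the least [v a_s + eps_(block of s)]. Modulo terms of
    valuation above [k], the coefficients of [\sum_s a_s alpha'_s] on block [i]
    are those of [a] on that block multiplied by the invertible [T_ii], so they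
    cannot all have valuation above [k] ([block_triangular_reduced]).

    Membership in [B] is controlled by [w]: integral elements have nonnegative
    value, and an element of nonnegative value acts on a suitably rescaled
    reduced basis by a matrix with entries in [A], hence is integral
    ([int_closureP]). Therefore a reduced basis is an integral basis exactly
    when its values are in [0, 1) ([reduced_integral_basis]).

    A minimum over an empty family of valuations would be constantly infinite,
    so it also has to be shown that [v] extends to [L] at all. A maximal subring
    of [L] among those containing [A] but not [pi^-1] is a valuation ring, and
    its value group is rational because [L] is algebraic over [K]
    ([exists_extension]). *)

(** * Values of sums and powers *)

Section ValuationTheory.
Variables (R : realDomainType) (F : fieldType) (v : valuation R F).
Implicit Types x y : F.

Lemma val_lty x : (v x < +oo)%E = (x != 0).
Proof.
have [->|x0] := eqVneq x 0; first by rewrite val_zero ltxx.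
by have [r ->] := val_real v x0; rewrite ltry.
Qed.

Lemma val_EFin_neq0 x r : v x = r%:E%E -> x != 0.
Proof. by move=> vx; rewrite -val_lty vx ltry. Qed.

Lemma val_sum_ge I (s : seq I) (P : pred I) (f : I -> F) (r : \bar R) :
  (forall i, P i -> (r <= v (f i))%E) -> (r <= v (\sum_(i <- s | P i) f i)%R)%E.
Proof.
move=> rf; elim/big_ind: _ => // [|x y rx ry]; first by rewrite val_zero leey.
by apply: le_trans (val_add v x y); rewrite le_min rx.
Qed.

Lemma val_sum_gt I (s : seq I) (P : pred I) (f : I -> F) (r : R) :
  (forall i, P i -> (r%:E < v (f i))%E) ->
  (r%:E < v (\sum_(i <- s | P i) f i)%R)%E.
Proof.
move=> rf; elim/big_ind: _ => // [|x y rx ry]; first by rewrite val_zero ltry.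
by apply: lt_le_trans (val_add v x y); rewrite lt_min rx.
Qed.

Lemma val_addl x y : (v x < v y)%E -> v (x + y) = v x.
Proof.
move=> xy; apply: le_anti; apply/andP; split; last first.
  by apply: le_trans (val_add v x y); rewrite le_min lexx ltW.
have := val_add v (x + y) (- y); rewrite addrK val_opp ge_min => /orP[] //.
by rewrite leNgt xy.
Qed.

Lemma val_expr x r k : v x = r%:E%E -> v (x ^+ k) = (r *+ k)%:E%E.
Proof.
move=> vx; elim: k => [|k IH]; first by rewrite val_one.
by rewrite exprS val_mul vx IH -EFinD mulrS.
Qed.

Lemma val_invr x r : v x = r%:E%E -> v x^-1 = (- r)%:E%E.
Proof.
move=> vx; have x0 := val_EFin_neq0 vx.
have := val_inv v x0; have [s ->] := val_real v (invr_neq0 x0).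
by rewrite vx -EFinD => -[] /eqP; rewrite addrC addr_eq0 => /eqP ->.
Qed.

Lemma val_exprz x r (k : int) : v x = r%:E%E -> v (x ^ k) = (r *~ k)%:E%E.
Proof.
move=> vx; case: k => k; first by rewrite -exprnP -pmulrn (val_expr _ vx).
by rewrite NegzE -exprnN mulrNz -pmulrn; apply: val_invr (val_expr _ vx).
Qed.

End ValuationTheory.

(** * Existence of an extension of the valuation *)

Section DominatingRing.
Variables (L : fieldType) (p : L) (S : subringClosed L).
Hypothesis pS : p \in S.
Hypothesis pVS : p^-1 \notin S.

Let p0 : p != 0.
Proof. by apply: contraNneq pVS => ->; rewrite invr0 rpred0. Qed.

Lemma mul_p_neq1 s : s \in S -> p * s != 1.
Proof.
by move=> sS; apply: contraNneq pVS => /(canRL (mulKf p0)); rewrite mulr1 => <-.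
Qed.

(* Maximality of S among the subrings without p^-1, unfolded: adjoining any
   further element produces a polynomial expression for p^-1. *)
Hypothesis S_max : forall x, x \notin S ->
  exists2 q, q \is a polyOver S & p * q.[x] = 1.

Lemma expr_mul_horner_inv (q : {poly L}) x m : x != 0 -> (size q <= m.+1)%N ->
  x ^+ m * q.[x^-1] = \sum_(i < size q) q`_i * x ^+ (m - i).
Proof.
move=> x0 qm; rewrite horner_coef mulr_sumr; apply: eq_bigr => i _.
have im : (i <= m)%N by rewrite -ltnS (leq_trans (ltn_ord i)).
by rewrite mulrCA exprVn -expfB_cond ?(negPf x0).
Qed.

(** If the inverse of [u = 1 - p * s] could be adjoined only by inverting [p],
    a power of [u] would be both a multiple of [p] and congruent to 1 mod [p]. *)
Lemma one_sub_p_inv s : s \in S -> (1 - p * s)^-1 \in S.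
Proof.
move=> sS; set u := 1 - p * s.
have u0 : u != 0 by rewrite subr_eq0 eq_sym mul_p_neq1.
have uS : u \in S by rewrite rpredB ?rpred1 ?rpredM.
case: (boolP (u^-1 \in S)) => // /S_max[q qS pq].
have um m : exists2 r, r \in S & u ^+ m = 1 - p * r.
  elim: m => [|m [r rS um]]; first by exists 0; rewrite ?rpred0 // mulr0 subr0.
  exists (s + r - p * s * r); first by rewrite !(rpredB, rpredD, rpredM).
  by rewrite exprS um /u; ring.
have [r rS ur] := um (size q).
have := expr_mul_horner_inv u0 (leqnSn (size q)).
set t := \sum_(_ < _) _ => Et.
have tS : t \in S.
  by apply: rpred_sum => i _; rewrite rpredM ?rpredX // (polyOverP qS).
have /negP[] := mul_p_neq1 (rpredD rS tS); apply/eqP.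
by rewrite mulrDr -Et mulrCA pq mulr1 ur addrC subrK.
Qed.

(** The relation [q'] of degree [m], multiplied by [x ^+ m], expresses [x ^+ m]
    by lower powers of [x] because [1 - p * q'`_0] is invertible in
    [S]; substituting this into the leading term of the other relation lowers
    its degree. *)
Lemma relation_descent x (q q' : {poly L}) : x != 0 ->
  q \is a polyOver S -> q' \is a polyOver S ->
  p * q.[x] = 1 -> p * q'.[x^-1] = 1 -> (size q' <= size q)%N ->
  exists q1 : {poly L},
    [/\ q1 \is a polyOver S, p * q1.[x] = 1 & (size q1 < size q)%N].
Proof.
move=> x0 qS q'S pq pq' le_q'q.
case Em: (size q') => [|m].
  move/eqP: Em pq'; rewrite size_poly_eq0 => /eqP ->.
  by rewrite horner0 mulr0 => /esym/eqP; rewrite oner_eq0.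
case En: (size q) => [|n]; first by move: le_q'q; rewrite En Em.
set u := 1 - p * q'`_0.
have u0 : u != 0 by rewrite subr_eq0 eq_sym mul_p_neq1 ?(polyOverP q'S).
have uVS : u^-1 \in S by rewrite one_sub_p_inv ?(polyOverP q'S).
pose r := \sum_(i < m) (u^-1 * (p * q'`_i.+1)) *: 'X^(m - i.+1).
have rS : r \is a polyOver S.
  apply: rpred_sum => i _; apply: polyOverZ; last by rewrite rpredX ?polyOverX.
  by rewrite !rpredM // (polyOverP q'S).
have r_size : (size r <= m)%N.
  apply: leq_trans (size_sum _ _ _) _; apply/bigmax_leqP => i _.
  apply: leq_trans (size_scale_leq _ _) _.
  by rewrite size_polyXn; have := ltn_ord i; lia.
have xm : x ^+ m = r.[x].
  apply: (mulfI u0); rewrite horner_sum mulr_sumr.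
  transitivity (p * \sum_(i < m) q'`_i.+1 * x ^+ (m - i.+1)).
    have le_m : (size q' <= m.+1)%N by rewrite Em.
    have := expr_mul_horner_inv x0 le_m.
    rewrite Em big_ord_recl subn0 => /(congr1 ( *%R p)).
    rewrite mulrCA pq' mulr1 mulrDr => xmE.
    by rewrite mulrBl mul1r {1}xmE; rewrite mulrA addrC addKr.
  rewrite mulr_sumr; apply: eq_bigr => i _.
  by rewrite hornerZ hornerXn !mulrA mulfV // mul1r.
exists (take_poly n q + q`_n *: 'X^(n - m) * r); split.
- apply: rpredD; last by rewrite rpredM // polyOverZ ?rpredX ?polyOverX ?(polyOverP qS).
  by apply: polyOver_poly => i _; rewrite (polyOverP qS).
- rewrite -pq; congr (_ * _).
  rewrite hornerD hornerM hornerZ hornerXn -xm -mulrA -exprD subnK; last first.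
    by move: le_q'q; rewrite En Em.
  rewrite [in RHS]horner_coef En big_ord_recr /= horner_poly.
  by [].
- apply: leq_trans (size_polyD _ _) _; rewrite geq_max; apply/andP; split.
    exact: size_poly.
  apply: leq_trans (size_polyMleq _ _) _.
  have : (size (q`_n *: 'X^(n - m)) <= (n - m).+1)%N.
    by apply: leq_trans (size_scale_leq _ _) _; rewrite size_polyXn.
  move: le_q'q r_size; rewrite En Em; move: (size r) (size _) => a b; lia.
Qed.

Lemma no_relation_pair N x (q q' : {poly L}) : x != 0 ->
  q \is a polyOver S -> q' \is a polyOver S ->
  p * q.[x] = 1 -> p * q'.[x^-1] = 1 -> (size q + size q' <= N)%N -> False.
Proof.
elim: N x q q' => [|N IH] x q q' x0 qS q'S pq pq' leN.
  have q0 : q = 0 by apply/eqP; rewrite -size_poly_eq0; lia.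
  by move: pq; rewrite q0 horner0 mulr0 => /esym/eqP; rewrite oner_eq0.
have [le_q'q|/ltnW le_qq'] := leqP (size q') (size q).
  have [q1 [q1S pq1 lt1]] := relation_descent x0 qS q'S pq pq' le_q'q.
  by apply: (IH x q1 q') => //; lia.
have pq2 : p * q.[x^-1^-1] = 1 by rewrite invrK.
have [q1 [q1S pq1 lt1]] := relation_descent (invr_neq0 x0) q'S qS pq' pq2 le_qq'.
by apply: (IH x^-1 q1 q) => //; [rewrite invr_neq0|lia].
Qed.

Lemma maximal_is_valuation_ring x : (x \in S) || (x^-1 \in S).
Proof.
case: (boolP (x \in S)) => //= xS; case: (boolP (x^-1 \in S)) => //= xVS.
have x0 : x != 0 by apply: contraNneq xS => ->; rewrite rpred0.
have [q qS pq] := S_max xS; have [q' q'S pq'] := S_max xVS.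
by case: (no_relation_pair x0 qS q'S pq pq' (leqnn _)).
Qed.

End DominatingRing.

Section RankOneValuation.
Variables (K : fieldType) (v : valuation int K) (L : fieldExtType K).
Variables (pi : K) (v_pi : v pi = 1%:E%E).
Variable O : subringClosed L.
Hypothesis A_sub_O : forall a, (0 <= v a)%E -> a%:A \in O.
Hypothesis piV_notin_O : (pi%:A : L)^-1 \notin O.
Hypothesis O_total : forall x, (x \in O) || (x^-1 \in O).

Let p : L := pi%:A.
Let U : pred L := fun x => (x != 0) && (x \in O) && (x^-1 \in O).

Let pi0 : pi != 0. Proof. exact: val_EFin_neq0 v_pi. Qed.
Let p0 : p != 0. Proof. by rewrite scaler_eq0 oner_eq0 orbF. Qed.

Let UP x : U x -> [/\ x != 0, x \in O & x^-1 \in O].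
Proof. by case/andP => /andP[]. Qed.

Let U1 : U 1. Proof. by rewrite /U oner_neq0 invr1 rpred1. Qed.

Let UM x y : U x -> U y -> U (x * y).
Proof.
move=> /UP[x0 xO xVO] /UP[y0 yO yVO].
by rewrite /U mulf_neq0 // invfM !rpredM.
Qed.

Let UV x : U x -> U x^-1.
Proof. by case/UP=> x0 xO xVO; rewrite /U invr_neq0 // invrK xO xVO. Qed.

Let UX x k : U x -> U (x ^+ k).
Proof. by move=> Ux; elim: k => [//|k IH]; rewrite exprS UM. Qed.

Lemma unit_base a : v a = 0%:E%E -> U a%:A.
Proof.
move=> va; have a0 := val_EFin_neq0 va.
have vVa := val_invr va.
rewrite /U scaler_eq0 oner_eq0 orbF a0 A_sub_O ?va //=.
by rewrite -in_algE -fmorphV A_sub_O // vVa oppr0.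
Qed.

Lemma unit_base_pi a k : v a = k%:E%E -> U (a%:A / p ^ k).
Proof.
move=> va; have a0 := val_EFin_neq0 va.
rewrite -in_algE /p -in_algE -rmorphXz ?unitfE // -fmorphV -rmorphM.
apply: unit_base; rewrite val_mul va (val_invr (val_exprz k v_pi)).
by rewrite -EFinD -mulrzl mulr1 intz subrr.
Qed.

Lemma unit_pi_exprz k : U (p ^ k) -> k = 0.
Proof.
have aux (m : nat) : U (p ^+ m.+1) -> False.
  case/UP=> _ _ H; move: piV_notin_O; rewrite -/p => /negP[].
  have -> : p^-1 = p ^+ m * (p ^+ m.+1)^-1.
    by rewrite exprSr invfM mulrA mulfV ?mul1r // expf_neq0.
  by rewrite rpredM ?rpredX // A_sub_O // v_pi.
case: k => [[//|m]|m]; first by move/aux.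
by rewrite NegzE -exprnN => /UV; rewrite invrK => /aux.
Qed.

(** Valuation rings are local: whichever of [t / (1 + t)] and its inverse is in
    [O], it determines the inverse of [1 + t] or of [t]. *)
Lemma unit_one_add t : t \in O -> ~~ U t -> U (1 + t).
Proof.
have [->|t0 tO nUt] := eqVneq t 0; first by rewrite addr0.
have tVO : t^-1 \notin O by apply: contra nUt => tVO; rewrite /U t0 tO.
have t10 : 1 + t != 0.
  apply: contra tVO; rewrite addrC addr_eq0 => /eqP ->.
  by rewrite invrN1 rpredN rpred1.
rewrite /U t10 rpredD ?rpred1 //=.
case/orP: (O_total (t / (1 + t))) => [H|].
  have -> : (1 + t)^-1 = 1 - t / (1 + t).
    by apply: (mulfI t10); rewrite mulrBr mulr1 mulrCA mulfV // mulr1 addrK.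
  by rewrite rpredB ?rpred1.
rewrite invfM invrK => H; case/negP: tVO.
have -> : t^-1 = t^-1 * (1 + t) - 1 by rewrite mulrDr mulr1 mulVf // addrK.
by rewrite rpredB ?rpred1.
Qed.

Lemma unit_add x y : x != 0 -> y != 0 -> ~~ U (x / y) ->
  U ((x + y) / x) || U ((x + y) / y).
Proof.
move=> x0 y0 nU; rewrite !mulrDl !divff // [_ + 1]addrC.
case/orP: (O_total (x / y)) => xyO; first by rewrite (unit_one_add xyO) ?orbT.
rewrite unit_one_add //; first by rewrite -[y / x]invrK invf_div.
by apply: contra nU => /UV; rewrite invf_div.
Qed.

(** Each partial sum has the value of one of its terms, hence a value distinct
    from that of the next term, and [unit_add] applies again. *)
Lemma unit_sum (s : seq L) : s != [::] -> all (predC1 0) s ->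
  pairwise (fun x y => ~~ U (x / y)) s ->
  has (fun y => U ((\sum_(x <- s) x) / y)) s.
Proof.
elim: s => // x s IH _; have [->|s_neq0] := eqVneq s [::].
  by rewrite /= andbT orbF big_seq1 => x0 _; rewrite divff.
move=> /= /andP[x0 s'0] /andP[/allP/= nUx s'p].
have /hasP[z zs' Uz] := IH s_neq0 s'0 s'p.
rewrite big_cons; set S := \sum_(_ <- _) _ in Uz *.
have z0 : z != 0 by have /allP/(_ z zs') := s'0.
have S0 : S != 0.
  by apply: contraTneq Uz => ->; rewrite mul0r /U eqxx.
have : ~~ U (x / S).
  apply: contra (nUx z zs') => UxS.
  have -> : x / z = (x / S) * (S / z) by rewrite mulrA divfK.
  exact: UM.
case/(unit_add x0 S0)/orP => [-> //|US].
apply/orP; right; apply/hasP; exists z => //.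
have -> : (x + S) / z = (x + S) / S * (S / z) by rewrite mulrA divfK.
exact: UM.
Qed.

(** Two terms of an algebraic equation of [x] over [K] must have the same value,
    so some power of [x] has the value of a power of [pi]. *)
Lemma torsion_value x : x != 0 -> exists Na : nat * int, U (x ^+ Na.1.+1 / p ^ Na.2).
Proof.
move=> x0; apply: contrapT => noNa.
have /polyOver1P[q Eq] := minPolyOver 1 x.
have q_monic : q \is monic.
  by have := monic_minPoly 1 x; rewrite Eq map_monic.
have rq := root_minPoly 1 x; rewrite Eq in rq.
pose T i : L := (q`_i)%:A * x ^+ i.
pose idx := [seq i <- iota 0 (size q) | q`_i != 0].
have Sum0 : \sum_(y <- [seq T i | i <- idx]) y = 0.
  rewrite big_map big_filter big_mkcond /= -[RHS](rootP rq).
  rewrite horner_coef size_map_poly -[X in iota 0 X]subn0 -/(index_iota _ _) big_mkord.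
  apply: eq_bigr => i _; rewrite coef_map /T; case: eqP => //= ->.
  by rewrite scale0r mul0r.
have qn0 i : i \in idx -> q`_i != 0 by rewrite mem_filter => /andP[].
have : has (fun y => U ((\sum_(x <- [seq T i | i <- idx]) x) / y)) [seq T i | i <- idx].
  apply: unit_sum.
  - have : (size q).-1 \in idx.
      rewrite mem_filter mem_iota -/(lead_coef q) lead_coef_eq0 monic_neq0 //=.
      by rewrite prednK // lt0n size_poly_eq0 monic_neq0.
    by apply: contraTneq => /eqP; rewrite -size_eq0 size_map size_eq0 => /eqP ->.
  - apply/allP => _ /mapP[i /qn0 qi ->] /=.
    by rewrite /T mulf_neq0 ?expf_neq0 // scaler_eq0 oner_eq0 orbF.
  rewrite pairwise_map.
  have : pairwise ltn idx.
    rewrite -sorted_pairwise; last exact: ltn_trans.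
    by apply: sorted_filter; [exact: ltn_trans|exact: iota_ltn_sorted].
  apply: (@sub_in_pairwise _ (mem idx)); last exact/allP.
  move=> i j /qn0 qi /qn0 qj ij; apply/negP => UT; apply: noNa.
  have [k vk] : exists k, v (q`_j / q`_i) = k%:E%E.
    by apply: val_real; rewrite mulf_neq0 ?invr_neq0.
  exists ((j - i).-1, - k) => /=; rewrite prednK ?subn_gt0 //.
  have -> : x ^+ (j - i) / p ^ (- k) =
      (T i / T j)^-1 / ((q`_j / q`_i)%:A / p ^ k).
    have -> : x ^+ (j - i) = x ^+ j / x ^+ i.
      by rewrite expfB_cond ?(negPf x0) // ltnW.
    rewrite invf_div /T -invr_expz invrK.
    have -> : (q`_j / q`_i)%:A = (q`_j)%:A / (q`_i)%:A :> L.
      by rewrite -!in_algE fmorph_div.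
    have ci : (q`_i)%:A != 0 :> L by rewrite scaler_eq0 oner_eq0 orbF.
    have cj : (q`_j)%:A != 0 :> L by rewrite scaler_eq0 oner_eq0 orbF.
    by field; rewrite ci cj !expf_neq0 // expfz_neq0.
  by rewrite UM // UV // unit_base_pi.
by case/hasP => y _; rewrite Sum0 mul0r /U eqxx.
Qed.

Lemma torsion_value_unique x N M a b :
  U (x ^+ N.+1 / p ^ a) -> U (x ^+ M.+1 / p ^ b) ->
  a%:~R / N.+1%:R = b%:~R / M.+1%:R :> rat.
Proof.
move=> Ua Ub.
have x0 : x != 0.
  by apply: contraTneq Ua => ->; rewrite expr0n mul0r /U eqxx.
have H : U (p ^ (a * M.+1%:Z - b * N.+1%:Z)).
  have -> : p ^ (a * M.+1%:Z - b * N.+1%:Z) =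
      (x ^+ M.+1 / p ^ b) ^+ N.+1 / (x ^+ N.+1 / p ^ a) ^+ M.+1.
    rewrite !expr_div_n -!exprM [(M.+1 * _)%N]mulnC expfzDr // -invr_expz.
    rewrite -!exprz_exp -!exprnP.
    by field; rewrite !expf_neq0 ?expfz_neq0.
  by rewrite UM ?UV ?UX.
have /eqP := unit_pi_exprz H; rewrite subr_eq0 => /eqP abE.
apply/eqP; rewrite eqr_div ?pnatr_eq0 //.
by rewrite !pmulrn -!intrM abE.
Qed.

(** The value of [x] is [a / N] when [x ^+ N] and [pi ^ a] differ by a unit. *)
Definition rank_one_fun (x : L) : \bar rat :=
  if pselect (x != 0) is left x0 then
    let Na := xchoose (torsion_value x0) in (Na.2%:~R / Na.1.+1%:R)%:E%E
  else +oo%E.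

Lemma rank_one_funE x N a : U (x ^+ N.+1 / p ^ a) ->
  rank_one_fun x = (a%:~R / N.+1%:R)%:E%E.
Proof.
move=> Ua; have x0 : x != 0.
  by apply: contraTneq Ua => ->; rewrite expr0n mul0r /U eqxx.
rewrite /rank_one_fun; case: pselect => // x0'.
congr (_%:E%E); apply: torsion_value_unique Ua.
exact: (xchooseP (torsion_value x0')).
Qed.

Lemma rank_one_zero : rank_one_fun 0 = +oo%E.
Proof. by rewrite /rank_one_fun; case: pselect => // H; case/eqP: (H). Qed.

Lemma rank_one_fin x : x != 0 -> rank_one_fun x \is a fin_num.
Proof. by move=> x0; have [[N a] /= /rank_one_funE ->] := torsion_value x0. Qed.

Lemma rank_one_mul x y :
  rank_one_fun (x * y) = (rank_one_fun x + rank_one_fun y)%E.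
Proof.
have [->|x0] := eqVneq x 0.
  rewrite mul0r rank_one_zero; have [->|y0] := eqVneq y 0.
    by rewrite rank_one_zero.
  by rewrite addye // (contraTneq _ (rank_one_fin y0)) // => ->.
have [->|y0] := eqVneq y 0.
  by rewrite mulr0 rank_one_zero addey // (contraTneq _ (rank_one_fin x0)) // => ->.
have [[N a] /= Ux] := torsion_value x0; have [[M b] /= Uy] := torsion_value y0.
rewrite (rank_one_funE Ux) (rank_one_funE Uy) -EFinD.
have NM : (N.+1 * M.+1 = (N.+1 * M.+1).-1.+1)%N by rewrite prednK // muln_gt0.
rewrite (@rank_one_funE _ (N.+1 * M.+1).-1 (a * M.+1%:Z + b * N.+1%:Z)) -NM.
  by rewrite addf_div ?pnatr_eq0 // intrD !intrM natrM.
have -> : (x * y) ^+ (N.+1 * M.+1) / p ^ (a * M.+1%:Z + b * N.+1%:Z) =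
    (x ^+ N.+1 / p ^ a) ^+ M.+1 * (y ^+ M.+1 / p ^ b) ^+ N.+1.
  rewrite !expr_div_n -!exprM [(M.+1 * N.+1)%N]mulnC expfzDr // exprMn.
  rewrite -!exprz_exp -!exprnP.
  by field; rewrite !expf_neq0 ?expfz_neq0.
by rewrite UM ?UX.
Qed.

(** [O] is integrally closed, so a root of an element of [O] is in [O]; this
    makes the ultrametric inequality a consequence of closure under addition. *)
Lemma rank_one_ge0 x : (0 <= rank_one_fun x)%E = (x \in O).
Proof.
have [->|x0] := eqVneq x 0; first by rewrite rank_one_zero leey rpred0.
have [[N a] /= Ux] := torsion_value x0.
rewrite (rank_one_funE Ux) lee_fin pmulr_lge0 ?invr_gt0 ?ltr0n // ler0z.
have [_ H1 H2] := UP Ux.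
apply/idP/idP => [|xO].
  case: a H1 H2 {Ux} => [a|//] H1 _ _.
  have xNO : x ^+ N.+1 \in O.
    rewrite -[X in X \in _](divfK (expf_neq0 a p0)) rpredM // rpredX //.
    by rewrite A_sub_O // v_pi.
  case/orP: (O_total x) => // xVO.
  have -> : x = x ^+ N.+1 * x^-1 ^+ N.
    by rewrite exprS exprVn mulfK // expf_neq0.
  by rewrite rpredM // rpredX.
case: a Ux H2 H1 => // a Ux H2 H1; case/negP: piV_notin_O; rewrite -/p.
move: H1; rewrite NegzE -exprnN invrK => H1.
have pO : p \in O by rewrite A_sub_O // v_pi.
have -> : p^-1 = (x ^+ N.+1 * p ^+ a.+1)^-1 * (x ^+ N.+1 * p ^+ a).
  by rewrite [p ^+ a.+1]exprS; field; rewrite p0 !expf_neq0.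
rewrite rpredM ?(rpredM, rpredX) //.
by move: H2; rewrite NegzE -exprnN invrK.
Qed.

Lemma rank_one_add x y :
  (Order.min (rank_one_fun x) (rank_one_fun y) <= rank_one_fun (x + y)%R)%E.
Proof.
wlog xy : x y / (rank_one_fun x <= rank_one_fun y)%E => [th|].
  by case/orP: (le_total (rank_one_fun x) (rank_one_fun y)) => /th //;
    rewrite minC addrC.
rewrite min_l //.
have [x0|x0] := eqVneq x 0.
  by move: xy; rewrite x0 rank_one_zero add0r.
have -> : x + y = x * (1 + y / x) by rewrite mulrDr mulr1 mulrCA mulfV // mulr1.
rewrite rank_one_mul leeDl // rank_one_ge0 rpredD ?rpred1 // -rank_one_ge0.
have := xy; have {1}-> : y = x * (y / x) by rewrite mulrCA mulfV // mulr1.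
rewrite rank_one_mul; have := rank_one_fin x0.
case: (rank_one_fun x) => // r _; case: (rank_one_fun (y / x)) => //= s.
by rewrite -EFinD !lee_fin lerDl.
Qed.

Definition rank_one_valuation : valuation rat L :=
  Valuation rank_one_zero rank_one_fin rank_one_mul rank_one_add.

Lemma rank_one_extends : extends_val v rank_one_valuation.
Proof.
move=> a /=; have [->|a0] := eqVneq a 0.
  by rewrite scale0r rank_one_zero val_zero.
have [k vk] := val_real v a0.
rewrite (@rank_one_funE _ 0 k) ?expr1 ?unit_base_pi // vk /=.
by rewrite divr1.
Qed.

End RankOneValuation.

Section Existence.
Variables (K : fieldType) (v : valuation int K) (L : fieldExtType K).
Variables (pi : K) (v_pi : v pi = 1%:E%E).

Let good (S : set L) := [/\ S 1, forall x y, S x -> S y -> S (x - y),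
  forall x y, S x -> S y -> S (x * y), forall a, (0 <= v a)%E -> S a%:A &
  ~ S (pi%:A)^-1].

(** The union of the empty chain is the empty set, hence the first disjunct of
    the predicate [P] to which Zorn's lemma is applied. *)
Lemma maximal_good : exists S, good S /\ forall S', good S' ->
  (forall x, S x -> S' x) -> forall x, S' x -> S x.
Proof.
pose P (S : set L) := (forall x, ~ S x) \/ good S.
have [F PF totF|S [PS maxS]] := @Zorn_bigcup L P.
  have [[X FX gX]|noX] := pselect (exists2 X, F X & good X); last first.
    left=> x [X FX Xx]; have [/(_ x)//|gX] := PF _ FX.
    by apply: noX; exists X.
  right; have [X1 XB XM XA XN] := gX.
  have common x y : (\bigcup_(X in F) X)%classic x -> (\bigcup_(X in F) X)%classic y ->
      exists Y, [/\ F Y, good Y, Y x & Y y].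
    move=> [Y FY Yx] [Z FZ Zy].
    have [YZ|ZY] := totF _ _ FY FZ.
      by exists Z; split=> //; [have [/(_ y)|] := PF _ FZ | apply: YZ].
    by exists Y; split=> //; [have [/(_ x)|] := PF _ FY | apply: ZY].
  split.
  - by exists X.
  - by move=> x y /common H /H{H} [Y [FY [_ YB _ _ _] Yx Yy]]; exists Y => //; apply: YB.
  - by move=> x y /common H /H{H} [Y [FY [_ _ YM _ _] Yx Yy]]; exists Y => //; apply: YM.
  - by move=> a va; exists X => //; apply: XA.
  - by move=> [Y FY Yp]; have [/(_ _ Yp)|[]] := PF _ FY.
have gA : good [set x | exists2 a, (0 <= v a)%E & x = a%:A]%classic.
  split.
  - by exists 1; rewrite ?val_one // scale1r.
  - move=> _ _ [a va ->] [b vb ->]; exists (a - b); rewrite ?scalerBl //.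
    by have := @rpredB _ (valring v) a b; rewrite !inE; apply.
  - move=> _ _ [a va ->] [b vb ->]; exists (a * b).
      by rewrite val_mul adde_ge0.
    by rewrite -!in_algE rmorphM.
  - by move=> a va; exists a.
  - case=> a va; rewrite -!in_algE -fmorphV => /fmorph_inj Ea.
    by move: va; rewrite -Ea (val_invr v_pi) lee_fin.
have gS : good S.
  case: PS => // S0; exfalso; apply: (maxS _ _ (or_intror gA)).
  split=> [x /S0//|]; move/(_ 1) => H; apply: (S0 1); apply: H.
  by exists 1; rewrite ?val_one ?scale1r.
exists S; split=> // S' gS' sSS' x S'x.
apply: contrapT => nSx; apply: (maxS S'); last by right.
by split=> // /(_ _ S'x).
Qed.

(** A subring of [L] that is maximal among those containing [A] but not
    [pi^-1] is a valuation ring dominating [A]. *)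
Lemma exists_extension : exists w : valuation rat L, extends_val v w.
Proof.
have [S [[S1 SB SM SA Sp] maxS]] := maximal_good.
pose SP : {pred L} := fun x => `[< S x >].
have SPP x : reflect (S x) (x \in SP) by apply: asboolP.
have cl : subring_closed SP.
  by split=> [|x y /SPP Sx /SPP Sy|x y /SPP Sx /SPP Sy]; apply/SPP; auto.
pose m := GRing.isSubringClosed.Build L SP cl.
pose O : subringClosed L := HB.pack SP m.
have OP x : reflect (S x) (x \in O) by apply: asboolP.
have pO : pi%:A \in O by apply/OP/SA; rewrite v_pi.
have pVO : (pi%:A : L)^-1 \notin O by apply/OP.
have p0 : pi%:A != 0 :> L by rewrite scaler_eq0 oner_eq0 orbF (val_EFin_neq0 v_pi).
have O_max x : x \notin O -> exists2 q, q \is a polyOver O & pi%:A * q.[x] = 1.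
  move=> /OP nSx.
  pose S' : set L := [set y | exists2 q, q \is a polyOver O & y = q.[x]]%classic.
  have sub y : S y -> S' y.
    by move/OP=> Oy; exists y%:P; rewrite ?polyOverC // hornerC.
  have [|nS'p] := pselect (S' (pi%:A)^-1).
    by case=> q qO Eq; exists q => //; rewrite -Eq mulfV.
  exfalso; apply/nSx/(maxS S') => //; last by exists 'X; rewrite ?polyOverX ?hornerX.
  split=> //.
  - exact: sub.
  - by move=> _ _ [q qO ->] [r rO ->]; exists (q - r); rewrite ?rpredB ?hornerD ?hornerN.
  - by move=> _ _ [q qO ->] [r rO ->]; exists (q * r); rewrite ?rpredM ?hornerM.
  - by move=> a va; apply/sub/SA.
have O_total := maximal_is_valuation_ring pO pVO O_max.
have O_A a : (0 <= v a)%E -> a%:A \in O by move=> va; apply/OP/SA.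
by exists (rank_one_valuation v_pi O_A pVO O_total); apply: rank_one_extends.
Qed.

End Existence.

(** * The minimum of the extensions and reduced families *)

Section BaseValue.
Variables (K : fieldType) (v : valuation int K).
Local Notation "'va' a" := (er_map intr (v a) : \bar rat) (at level 10, a at level 8).

Lemma base_val a : a != 0 -> exists2 k : int, v a = k%:E%E & va a = k%:~R%:E%E.
Proof. by move=> a0; have [k vk] := val_real v a0; exists k; rewrite vk. Qed.

Lemma base_val0 : va 0 = +oo%E.
Proof. by rewrite val_zero. Qed.

(** The values of [K] are integers, so an inequality of rationals with an
    error below 1 can be rounded. *)
Lemma base_val_ge (k : int) a (r d : rat) : k%:~R + d < r + 1 ->
  (r%:E <= va a + d%:E)%E -> (k%:E <= v a)%E.
Proof.
have [->|a0] := eqVneq a 0; first by move=> *; rewrite val_zero leey.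
have [l -> /= H] := base_val a0; rewrite -EFinD !lee_fin => H1 H2.
have : k%:~R < (l + 1)%:~R :> rat. by rewrite intrD; lra.
by rewrite ltr_int ltzD1.
Qed.

Lemma base_val_gt (k : int) a (r d : rat) : k%:~R + d <= r + 1 ->
  (r%:E < va a + d%:E)%E -> (k%:E <= v a)%E.
Proof.
have [->|a0] := eqVneq a 0; first by move=> *; rewrite val_zero leey.
have [l -> /= H] := base_val a0; rewrite -EFinD lte_fin lee_fin => H1 H2.
have : k%:~R < (l + 1)%:~R :> rat. by rewrite intrD; lra.
by rewrite ltr_int ltzD1.
Qed.

Lemma le_base_val (k : int) a (r d : rat) : r <= k%:~R + d ->
  (k%:E <= v a)%E -> (r%:E <= va a + d%:E)%E.
Proof.
have [->|a0] := eqVneq a 0; first by move=> *; rewrite base_val0 addye ?leey.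
have [l -> ->] := base_val a0; rewrite -EFinD !lee_fin -(ler_int rat); lra.
Qed.

Lemma lt_base_val (k : int) a (r d : rat) : r < k%:~R + d ->
  (k%:E <= v a)%E -> (r%:E < va a + d%:E)%E.
Proof.
have [->|a0] := eqVneq a 0; first by move=> *; rewrite base_val0 addye ?ltry.
have [l -> ->] := base_val a0; rewrite -EFinD lee_fin lte_fin -(ler_int rat); lra.
Qed.

Lemma base_val_gt0 a : (0 < v a)%E = (1%:E <= v a)%E.
Proof.
have [->|a0] := eqVneq a 0; first by rewrite val_zero leey ltry.
by have [k -> _] := base_val a0; rewrite lte_fin lee_fin -gtz0_ge1.
Qed.

End BaseValue.

Section MinimumValuation.
Variables (K : fieldType) (v : valuation int K) (L : fieldExtType K).
Variables (t : nat) (w : 'I_t -> valuation rat L).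
Hypothesis w_ext : forall i, extends_val v (w i).
Local Notation "'va' a" := (er_map intr (v a) : \bar rat) (at level 10, a at level 8).
Local Notation W := (minval w).

Lemma minval_geP r x : reflect (forall i, (r <= w i x)%E) (r <= W x)%E.
Proof.
apply: (iffP (bigmin_geP _ _ _ _)) => [[_ H] i|H]; first exact: H.
by split; rewrite ?leey.
Qed.

Lemma minval_gtP (r : rat) x :
  reflect (forall i, (r%:E < w i x)%E) (r%:E < W x)%E.
Proof.
apply: (iffP (bigmin_gtP _ _ _ _)) => [[_ H] i|H]; first exact: H.
by split; rewrite ?ltry.
Qed.

Lemma minval_sum_ge I (s : seq I) (P : pred I) (f : I -> L) r :
  (forall i, P i -> (r <= W (f i))%E) -> (r <= W (\sum_(i <- s | P i) f i)%R)%E.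
Proof.
by move=> H; apply/minval_geP => i; apply: val_sum_ge => j /H/minval_geP.
Qed.

Lemma minval_sum_gt I (s : seq I) (P : pred I) (f : I -> L) (r : rat) :
  (forall i, P i -> (r%:E < W (f i))%E) ->
  (r%:E < W (\sum_(i <- s | P i) f i)%R)%E.
Proof.
by move=> H; apply/minval_gtP => i; apply: val_sum_gt => j /H/minval_gtP.
Qed.

Lemma minval0 : W 0 = +oo%E.
Proof. by apply: le_anti; rewrite leey; apply/minval_geP => i; rewrite val_zero. Qed.

Lemma ext_scale i a x : w i (a *: x) = (va a + w i x)%E.
Proof. by rewrite -mulr_algl val_mul w_ext. Qed.

Lemma minval_mem x : x != 0 -> (0 < t)%N -> exists i, W x = w i x.
Proof.
move=> x0; case: t w => // t' w' _.
have [|i _ Ei] := @eq_bigmin _ _ _ +oo%E ord0 predT (fun i => w' i x) isT.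
  by move=> i _; rewrite leey.
by exists i.
Qed.

Lemma minval_real x : x != 0 -> (0 < t)%N -> exists r, W x = r%:E%E.
Proof. by move=> x0 t0; have [i ->] := minval_mem x0 t0; apply: val_real. Qed.

Lemma minval_scale a x : W (a *: x) = (va a + W x)%E.
Proof.
have [->|a0] := eqVneq a 0.
  rewrite scale0r minval0 base_val0 addye //.
  have [->|x0] := eqVneq x 0; first by rewrite minval0.
  have [t0|] := posnP t; last by move/(minval_real x0) => [r ->].
  suff -> : W x = +oo%E by [].
  apply: le_anti; rewrite leey; apply/minval_geP => i.
  by have := ltn_ord i; rewrite {2}t0.
have [k Ek vak] := base_val v a0.
have vaVk : va a^-1 = (- k%:~R)%:E%E by rewrite (val_invr Ek) /= intrN.
have half (b : K) (s : rat) y : va b = s%:E%E -> (s%:E + W y <= W (b *: y))%E.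
  move=> vb; apply/minval_geP => i; rewrite ext_scale vb leeD2lE //.
  by have /minval_geP := lexx (W y).
apply: le_anti; rewrite vak half // andbT.
have := half _ _ (a *: x) vaVk; rewrite scalerK // => H.
have := leeD2l k%:~R%:E%E H.
by rewrite addeA -EFinD subrr add0e.
Qed.

Lemma minval_opp x : W (- x) = W x.
Proof. by apply: eq_bigr => i _; apply: val_opp. Qed.

Lemma minval_add x y : (Order.min (W x) (W y) <= W (x + y)%R)%E.
Proof.
apply/minval_geP => i; apply: le_trans (val_add (w i) x y).
rewrite le_min !ge_min; apply/andP; split; apply/orP.
  by left; exact: bigmin_le.
by right; exact: bigmin_le.
Qed.

Lemma minval_mul_ge0 x y : (0 <= W x)%E -> (0 <= W y)%E -> (0 <= W (x * y)%R)%E.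
Proof.
move=> /minval_geP x0 /minval_geP y0.
by apply/minval_geP => i; rewrite val_mul adde_ge0.
Qed.

(** Taking the coordinate families for [a] shows that [d j] is the value of
    [b j]; making these rationals explicit keeps the arithmetic of values out
    of the extended rationals. *)
Definition reduced_with n (b : 'I_n -> L) (d : 'I_n -> rat) :=
  forall a : 'I_n -> K, W (\sum_i a i *: b i) =
    \big[Order.min/+oo%E]_i (va (a i) + (d i)%:E)%E.

Section ReducedFamily.
Variables (n : nat) (b : 'I_n -> L) (d : 'I_n -> rat).
Hypothesis bd : reduced_with b d.

Lemma reduced_geP (r : \bar rat) a :
  reflect (forall j, (r <= va (a j) + (d j)%:E)%E) (r <= W (\sum_i a i *: b i))%E.
Proof.
rewrite bd; apply: (iffP (bigmin_geP _ _ _ _)) => [[_ H] i|H]; first exact: H.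
by split; rewrite ?leey.
Qed.

Lemma reduced_gtP (r : rat) a :
  reflect (forall j, (r%:E < va (a j) + (d j)%:E)%E)
          (r%:E < W (\sum_i a i *: b i)%R)%E.
Proof.
rewrite bd; apply: (iffP (bigmin_gtP _ _ _ _)) => [[_ H] i|H]; first exact: H.
by split; rewrite ?ltry.
Qed.

Lemma reduced_val j : W (b j) = (d j)%:E%E.
Proof.
have := bd (fun i => (i == j)%:R).
rewrite (bigD1 j) //= eqxx scale1r big1 ?addr0 => [->|i /negPf ->]; last first.
  by rewrite scale0r.
rewrite (bigminD1 j) //= eqxx val_one /= add0e min_l //.
apply: le_bigmin => [|i /negPf ->]; first exact: leey.
by rewrite base_val0 addye ?leey.
Qed.

Lemma reduced_free a : \sum_i a i *: b i = 0 -> forall j, a j = 0.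
Proof.
move=> a0 j; apply/eqP; apply: contraT => /(base_val v)[k _ vk].
have /reduced_geP/(_ j) : (+oo <= W (\sum_i a i *: b i))%E by rewrite a0 minval0.
by rewrite vk -EFinD.
Qed.

Lemma reduced_inj a a' :
  \sum_i a i *: b i = \sum_i a' i *: b i -> forall j, a j = a' j.
Proof.
move/eqP; rewrite -subr_eq0 -sumrB => /eqP a0 j; apply/eqP; rewrite -subr_eq0.
apply/eqP; apply: (reduced_free (a := fun j => a j - a' j)); rewrite -[RHS]a0.
by apply: eq_bigr => i _; rewrite scalerBl.
Qed.

Hypothesis dimL : \dim {:L} = n.

Lemma reduced_span x : exists a, x = \sum_i a i *: b i.
Proof.
pose X := [tuple b i | i < n].
have X_basis : basis_of {:L} X.
  rewrite basisEfree subvf size_tuple dimL leqnn andbT andbT.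
  apply/freeP => k Xk0 j; apply: (reduced_free (a := k)); rewrite -[RHS]Xk0.
  by apply: eq_bigr => i _; rewrite -tnth_nth tnth_mktuple.
exists (fun i => coord X i x); rewrite {1}(coord_basis X_basis (memvf x)).
by apply: eq_bigr => i _; rewrite -tnth_nth tnth_mktuple.
Qed.

End ReducedFamily.

Lemma reducedP n (alpha : 'cV[L]_n) : (0 < t)%N ->
  reduced w alpha -> exists d, reduced_with (fun i => alpha i 0) d.
Proof.
move=> t0 [nz red].
have /fin_all_exists[d Ed] i : exists r, W (alpha i 0) = r%:E%E.
  exact: minval_real.
exists d => a; rewrite red; apply: eq_bigr => i _.
by rewrite minval_scale Ed.
Qed.

Lemma reduced_withP n (alpha : 'cV[L]_n) d :
  reduced_with (fun i => alpha i 0) d -> reduced w alpha.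
Proof.
move=> bd; split=> [i|a].
  apply: contraTneq (leey (W (alpha i 0))) => ai0.
  by have := reduced_val bd i; rewrite ai0 minval0.
by rewrite bd; apply: eq_bigr => i _; rewrite minval_scale (reduced_val bd).
Qed.

End MinimumValuation.

(** * Integral elements *)

Section Integrality.
Variables (K : fieldType) (v : valuation int K) (L : fieldExtType K).
Variables (pi : K) (v_pi : v pi = 1%:E%E).
Variables (t : nat) (w : 'I_t -> valuation rat L).
Hypothesis w_ext : forall i, extends_val v (w i).
Local Notation "'va' a" := (er_map intr (v a) : \bar rat) (at level 10, a at level 8).
Local Notation W := (minval w).
Local Notation A := (valRing v).

Let iota : {rmorphism A -> L} := GRing.in_alg L \o val.

Lemma valring_ge0 (a : A) : (0 <= v (val a))%E.
Proof. exact: (valP a). Qed.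

Lemma ext_inL_ge0 i (a : A) : (0 <= w i (iota a))%E.
Proof.
rewrite /= w_ext; have := valring_ge0 a; case: (v _) => //= k.
by rewrite !lee_fin ler0z.
Qed.

(** If [w i x < 0], the leading term of a monic equation of [x] has a value
    strictly below those of all the other terms. *)
Lemma integral_minval_ge0 x : int_closure v x -> (0 <= W x)%E.
Proof.
case=> p p_monic px; apply/minval_geP => i; rewrite leNgt; apply/negP => wx0.
have x0 : x != 0 by apply: contraTneq wx0 => ->; rewrite val_zero.
have [r wx] := val_real (w i) x0; rewrite wx lte_fin in wx0.
have {px} : root (map_poly iota p) x by [].
have sz : (0 < size p)%N by rewrite lt0n size_poly_eq0 monic_neq0.
rewrite /root horner_coef size_map_poly_id0; last first.
  by rewrite (monicP p_monic) rmorph1 oner_neq0.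
under eq_bigr do rewrite coef_map.
rewrite -(prednK sz) big_ord_recr -[p`_ord_max]/(lead_coef p) (monicP p_monic).
rewrite [X in X * x ^+ ord_max](rmorph1 iota) mul1r [_ _ (x ^+ _)]addrC.
rewrite addr_eq0 => /eqP Ex.
have : ((r *+ (size p).-1)%:E < w i (x ^+ (size p).-1)%R)%E.
  rewrite [x ^+ _]Ex val_opp; apply: val_sum_gt => j _; rewrite val_mul.
  rewrite (val_expr _ wx).
  have lt : r *+ (size p).-1 < r *+ j by rewrite ltr_nMn2l.
  have := ext_inL_ge0 i p`_j; case: (w i _) => [s| |] //=; rewrite ?lee_fin => s0.
    by rewrite -EFinD lte_fin; lra.
  by rewrite addye // ltry.
by rewrite (val_expr _ wx) ltxx.
Qed.

(** Multiplication by [x] has entries in the valuation ring with respect to a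
    reduced basis of values in [0, 1), so [x] is an eigenvalue of a matrix
    over that ring. *)
Lemma normalized_minval_ge0_integral n (b : 'I_n -> L) (d : 'I_n -> rat) x :
  (0 < n)%N -> \dim {:L} = n -> reduced_with v w b d ->
  (forall j, 0 <= d j < 1) -> (0 <= W x)%E -> int_closure v x.
Proof.
move=> n0 dimL bd d01 x0.
have /fin_all_exists[M EM] j : exists a, x * b j = \sum_i a i *: b i.
  exact: reduced_span bd dimL _.
have MA j i : M j i \in valring v.
  have H : (0 <= W (x * b j)%R)%E.
    by apply: minval_mul_ge0 => //; rewrite (reduced_val bd) lee_fin; case/andP: (d01 j).
  rewrite EM in H; have /(_ i) := reduced_geP bd _ _ H.
  rewrite inE; apply: base_val_ge; rewrite mulr0z add0r add0r.
  by case/andP: (d01 i).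
pose N : 'M[A]_n := \matrix_(i, j) ValRing (MA j i).
exists (char_poly N); first exact: char_poly_monic.
rewrite -[map_poly _ _]/(map_poly iota _) map_char_poly -eigenvalue_root_char.
apply/eigenvalueP; exists (\row_i b i).
  apply/rowP => j; rewrite !mxE EM; apply: eq_bigr => i _.
  by rewrite !mxE /= mulr_algr.
apply/eqP => /rowP/(_ (Ordinal n0)); rewrite !mxE => b0.
by have := reduced_val bd (Ordinal n0); rewrite b0 minval0.
Qed.

Lemma reduced_normalize n (b : 'I_n -> L) d (k : 'I_n -> int) :
  reduced_with v w b d ->
  reduced_with v w (fun j => pi ^ k j *: b j) (fun j => d j + (k j)%:~R).
Proof.
move=> bd a.
under eq_bigr do rewrite scalerA.
rewrite bd; apply: eq_bigr => j _.
rewrite val_mul (val_exprz _ v_pi) intz.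
have [->|a0] := eqVneq (a j) 0; first by rewrite val_zero.
have [l -> _] := base_val v a0; rewrite -EFinD /= -!EFinD.
by rewrite intrD -addrA [d j + _]addrC.
Qed.

Section ReducedBasis.
Variables (n : nat) (b : 'I_n -> L) (d : 'I_n -> rat).
Hypotheses (n0 : (0 < n)%N) (dimL : \dim {:L} = n) (bd : reduced_with v w b d).

Lemma int_closureP x : int_closure v x <-> (0 <= W x)%E.
Proof.
split; first exact: integral_minval_ge0.
apply: (normalized_minval_ge0_integral n0 dimL
          (reduced_normalize (fun j => - Num.floor (d j)) bd)) => j.
by have := floor_itv (d j); rewrite intrN intrD; lra.
Qed.

(** If [d j >= 1], then [pi^-1 *: b j] is integral but has a coordinate outside
    [A]. *)
Lemma reduced_integral_basis (alpha : 'cV[L]_n) : (forall j, alpha j 0 = b j) ->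
  integral_basis v alpha <-> forall j, 0 <= d j < 1.
Proof.
move=> Eb; split=> [[int span] j|d01].
  have d0 : 0 <= d j.
    have := integral_minval_ge0 (int j).
    by rewrite Eb (reduced_val bd) lee_fin.
  rewrite d0 /= ltNge; apply/negP => d1.
  have /span[a [Ea _]] : int_closure v (pi^-1 *: b j).
    apply/int_closureP; rewrite (minval_scale w_ext) (reduced_val bd).
    apply: (@le_base_val _ _ (-1)); first by rewrite intrN; lra.
    by rewrite (val_invr v_pi).
  have : \sum_i (val (a 0 i)) *: b i = \sum_i (if i == j then pi^-1 else 0) *: b i.
    rewrite (bigD1 j (F := fun i => (if _ then _ else _) *: _)) //= eqxx.
    rewrite [X in _ = _ + X]big1 ?addr0 => [|i /negPf->]; last by rewrite scale0r.
    rewrite Ea; apply: eq_bigr => i _; by rewrite Eb /valRing_inL mulr_algl.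
  move=> /(reduced_inj bd)/(_ j); rewrite eqxx => Ej.
  by have := valring_ge0 (a 0 j); rewrite Ej (val_invr v_pi) lee_fin.
split=> [j|x /int_closureP x0].
  by apply/int_closureP; rewrite Eb (reduced_val bd) lee_fin; case/andP: (d01 j).
have [a Ea] := reduced_span bd dimL x.
have aA i : a i \in valring v.
  rewrite Ea in x0; have /(_ i) := reduced_geP bd _ _ x0.
  rewrite inE; apply: base_val_ge; rewrite mulr0z add0r add0r.
  by case/andP: (d01 i).
have E (c : 'rV[A]_n) : \sum_i valRing_inL L (c 0 i) * alpha i 0 =
    \sum_i val (c 0 i) *: b i.
  by apply: eq_bigr => i _; rewrite Eb /valRing_inL mulr_algl.
exists (\row_i ValRing (aA i)); split.
  by rewrite E Ea; apply: eq_bigr => i _; rewrite mxE.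
move=> c; rewrite E Ea => /(reduced_inj bd) Ec.
by apply/rowP => i; rewrite mxE; apply: val_inj; rewrite -Ec.
Qed.

End ReducedBasis.

End Integrality.

(** * Weak approximation *)

Lemma large_multiple (I : finType) (c d : I -> rat) (r : rat) :
  exists m, forall i, 0 < c i -> r < c i *+ m.+1 + d i.
Proof.
exists (\max_i Num.truncn ((r - d i) / c i)) => i ci.
rewrite -ltrBlDr -[_ *+ _]mulr_natl -ltr_pdivrMr //.
have [x0|x0] := ltP ((r - d i) / c i) 0; first by rewrite (lt_le_trans x0) ?ler0n.
have /andP[_ H] := truncn_itv x0.
apply: lt_le_trans H _; rewrite ler_nat ltnS.
exact: (@leq_bigmax _ (fun i => Num.truncn ((r - d i) / c i))).
Qed.

Section Damping.
Variables (F : fieldType) (v : valuation rat F) (z : F) (r : rat).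
Hypothesis vz : v z = r%:E%E.

(** For large [m], [damp m] approximates 1 where [z] has a pole and 0 where [z]
    has a zero. *)
Definition damp m := z ^+ m.+1 / (1 + z ^+ m.+1).

Lemma val_one_add_pos m : 0 < r -> v (1 + z ^+ m.+1) = 0%:E%E.
Proof.
move=> r0.
by rewrite val_addl ?val_one // (val_expr _ vz) lte_fin pmulrn_lgt0.
Qed.

Lemma val_one_add_neg m : r < 0 -> v (1 + z ^+ m.+1) = (r *+ m.+1)%:E%E.
Proof.
move=> r0; rewrite addrC val_addl (val_expr _ vz) //.
by rewrite val_one lte_fin pmulrn_llt0.
Qed.

Lemma val_damp_pos m : 0 < r -> v (damp m) = (r *+ m.+1)%:E%E.
Proof.
move=> r0; rewrite val_mul (val_expr _ vz) (val_invr (val_one_add_pos m r0)).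
by rewrite oppr0 adde0.
Qed.

Lemma val_damp_neg m : r < 0 -> v (damp m) = 0%:E%E.
Proof.
move=> r0; rewrite val_mul (val_expr _ vz) (val_invr (val_one_add_neg m r0)).
by rewrite -EFinD subrr.
Qed.

Lemma val_damp_sub1 m : r < 0 -> v (damp m - 1) = (- (r *+ m.+1))%:E%E.
Proof.
move=> r0; have vn := val_one_add_neg m r0.
have n0 := val_EFin_neq0 vn.
have -> : damp m - 1 = - (1 + z ^+ m.+1)^-1 by rewrite /damp; field.
by rewrite val_opp (val_invr vn).
Qed.

End Damping.

Section Approximation.
Variables (K : fieldType) (v : valuation int K) (L : fieldExtType K).
Variables (pi : K) (v_pi : v pi = 1%:E%E).
Variables (t : nat) (w : 'I_t -> valuation rat L).
Hypothesis w_ext : forall i, extends_val v (w i).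
Hypothesis w_inj : forall i j, w i =1 w j -> i = j.

Lemma ext_pi (i : 'I_t) (k : int) : w i (pi ^ k)%:A = (k%:~R)%:E%E.
Proof. by rewrite w_ext (val_exprz _ v_pi) /= intz. Qed.

(** A rational number between the two values turns, after taking a power of [x]
    and multiplying by a power of [pi], into a separation by signs. *)
Lemma separate_lt i j x a b : w i x = a%:E%E -> w j x = b%:E%E -> a < b ->
  exists y, (w i y < 0)%E /\ (0 < w j y)%E.
Proof.
move=> wa wb ab; pose c := (a + b) / 2%:R.
have ac : a < c by rewrite /c; lra.
have cb : c < b by rewrite /c; lra.
have Ec : (numq c)%:~R = c * `|denq c|%:R :> rat.
  rewrite -{2}(divq_num_den c) natr_absz gtr0_norm ?denq_gt0 // divfK //.
  by rewrite intr_eq0 denq_neq0.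
have N0 : 0 < `|denq c|%:R :> rat by rewrite ltr0n absz_gt0 denq_neq0.
exists (x ^+ `|denq c| * (pi ^ (- numq c))%:A).
rewrite !val_mul (val_expr _ wa) (val_expr _ wb) !ext_pi intrN Ec -!EFinD !lte_fin.
have E s : s *+ `|denq c| - c * `|denq c|%:R = (s - c) * `|denq c|%:R.
  by rewrite mulrBl -[s *+ _]mulr_natr.
by rewrite !E pmulr_llt0 // pmulr_lgt0 // subr_lt0 subr_gt0.
Qed.

Lemma separate i j : i != j -> exists y, (w i y < 0)%E /\ (0 < w j y)%E.
Proof.
move=> ij; have [x wx] : exists x, w i x <> w j x.
  by apply/existsNP => H; case/eqP: ij; apply: w_inj.
have x0 : x != 0 by apply/eqP => x0; apply: wx; rewrite x0 !val_zero.
have [a wa] := val_real (w i) x0; have [b wb] := val_real (w j) x0.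
have [ab|ba|ab] := ltgtP a b; last by case: wx; rewrite wa wb ab.
  exact: separate_lt wa wb ab.
by apply: separate_lt (val_invr wa) (val_invr wb) _; rewrite ltrN2.
Qed.

(** One more valuation [w j] is handled by multiplying an element [y] separating
    [w i] from [w j] by a high power of [z], which is damped first if [z] has
    a pole at [w j]. *)
Lemma separate_seq i (s : seq 'I_t) : i \notin s ->
  exists z, (w i z < 0)%E /\ forall j, j \in s -> (0 < w j z)%E.
Proof.
elim: s => [_|j s IH].
  by exists (pi ^ (- 1))%:A; split=> //; rewrite ext_pi lte_fin.
rewrite inE negb_or => /andP[ij /IH[z [wz sz]]].
have [y [wy jy]] := separate ij.
have z0 : z != 0 by apply: contraTneq wz => ->; rewrite val_zero.
have y0 : y != 0 by apply: contraTneq wy => ->; rewrite val_zero.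
have /fin_all_exists[c Ec] l : exists r, w l z = r%:E%E by apply: val_real.
have /fin_all_exists[d Ed] l : exists r, w l y = r%:E%E by apply: val_real.
have [m Hm] := large_multiple c d 0.
have sc l : l \in s -> 0 < c l by move/sz; rewrite Ec lte_fin.
have ci : c i < 0 by rewrite Ec lte_fin in wz.
have di : d i < 0 by rewrite Ed lte_fin in wy.
have dj : 0 < d j by rewrite Ed lte_fin in jy.
have [cj|cj|cj] := ltgtP (c j) 0.
- exists (damp z m * y); split.
    by rewrite val_mul (val_damp_neg (Ec i)) // Ed -EFinD lte_fin add0r.
  move=> l; rewrite inE => /predU1P[->|ls].
    by rewrite val_mul (val_damp_neg (Ec j)) // Ed -EFinD lte_fin add0r.
  by rewrite val_mul (val_damp_pos (Ec l)) ?sc // Ed -EFinD lte_fin Hm ?sc.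
- exists z; split=> // l; rewrite inE => /predU1P[->|/sz//].
  by rewrite Ec lte_fin.
- exists (z ^+ m.+1 * y); split.
    rewrite val_mul (val_expr _ (Ec i)) Ed -EFinD lte_fin.
    have : c i *+ m.+1 < 0 by rewrite pmulrn_llt0.
    lra.
  move=> l; rewrite inE => /predU1P[->|ls].
    by rewrite val_mul (val_expr _ (Ec j)) Ed -EFinD lte_fin cj mul0rn add0r.
  by rewrite val_mul (val_expr _ (Ec l)) Ed -EFinD lte_fin Hm ?sc.
Qed.

Lemma approximation i x (r : rat) : exists y,
  (r%:E < w i (y - x)%R)%E /\ forall j, j != i -> (r%:E < w j y)%E.
Proof.
have [->|x0] := eqVneq x 0.
  by exists 0; rewrite subr0; split=> [|j _]; rewrite val_zero ltry.
have [|z [wz sz]] := @separate_seq i [seq j <- enum 'I_t | j != i].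
  by rewrite mem_filter eqxx.
have z0 : z != 0 by apply: contraTneq wz => ->; rewrite val_zero.
have /fin_all_exists[c Ec] l : exists r, w l z = r%:E%E by apply: val_real.
have /fin_all_exists[d Ed] l : exists r, w l x = r%:E%E by apply: val_real.
have ci : c i < 0 by rewrite Ec lte_fin in wz.
have [m Hm] := large_multiple (fun l => `|c l|) d r.
exists (damp z m * x); split.
  have -> : damp z m * x - x = (damp z m - 1) * x by rewrite mulrBl mul1r.
  rewrite val_mul (val_damp_sub1 (Ec i)) // Ed -EFinD lte_fin.
  by have := Hm i; rewrite ltr0_norm // mulNrn oppr_gt0; apply.
move=> j ji; have cj : 0 < c j.
  by have := sz j; rewrite mem_filter ji mem_enum Ec lte_fin; apply.
rewrite val_mul (val_damp_pos (Ec j)) // Ed -EFinD lte_fin.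
by have := Hm j; rewrite gtr0_norm //; apply.
Qed.

End Approximation.

(** * Graded pieces and the number of basis vectors of a given value *)

Lemma inj_surj_ord n (g : 'I_n -> 'I_n) :
  injective g -> forall y, exists x, g x = y.
Proof.
move=> g_inj y; have /codomP[x ->] := inj_card_onto g_inj (leqnn _) y.
by exists x.
Qed.

Section Ramification.
Variables (K : fieldType) (v : valuation int K) (L : fieldExtType K).
Variables (pi : K) (v_pi : v pi = 1%:E%E).
Variables (w : valuation rat L) (w_ext : extends_val v w).

(** The quotient of the value group by [Z] has order [e], so [e] kills it and
    the value group lies in [e^-1 Z]; both have [e] classes modulo [Z], hence
    they are equal. *)
Lemma ramification_value e (r : rat) : ramification_index v w e ->
  (r * e%:R \is a Num.int) <-> exists2 x : L, x != 0 & w x = r%:E%E.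
Proof.
case=> c [c_val c_rep].
have rep_uniq i j (k : int) : c i = c j + k%:~R -> i = j.
  move=> cij; have [x x0 wx] := c_val i; have [l [_ l_uniq]] := c_rep x x0.
  rewrite -(l_uniq i); last by exists 1; rewrite ?oner_neq0 // val_one wx /= adde0.
  rewrite -(l_uniq j) //; exists (pi ^ k).
    by rewrite expfz_neq0 // (val_EFin_neq0 v_pi).
  by rewrite wx cij (val_exprz _ v_pi) /= intz.
have base_int (a : K) : a != 0 -> exists k : int, er_map intr (v a) = (k%:~R : rat)%:E%E.
  by move=> /(base_val v)[k]; exists k.
(* Translation by an element of the value group permutes the cosets; summing
   representatives shows that e kills the quotient. *)
have e_kills s : (exists2 x : L, x != 0 & w x = s%:E%E) -> s * e%:R \is a Num.int.
  case=> x x0 wx.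
  have /fin_all_exists[g /fin_all_exists[k cg]] j :
      exists i, exists k : int, c j + s = c i + k%:~R.
    have [y y0 wy] := c_val j.
    have [i [[a a0 Ea] _]] := c_rep (y * x) (mulf_neq0 y0 x0).
    have [k vk] := base_int a a0; exists i, k.
    by apply: EFin_inj; move: Ea; rewrite val_mul wy wx vk -!EFinD.
  have g_inj : injective g.
    move=> i j gij; apply: (rep_uniq _ _ (k i - k j)).
    by rewrite intrB; have := cg i; have := cg j; rewrite gij; lra.
  have : \sum_i (c i + s) = \sum_i (c (g i) + (k i)%:~R) by apply: eq_bigr.
  rewrite !big_split /= sumr_const card_ord.
  rewrite -(reindex_inj (F := c) (P := xpredT) g_inj) => /addrI.
  by rewrite mulr_natr => ->; apply: rpred_sum => i _; apply: intr_int.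
split=> [/intrP[m Em]|/e_kills//].
have e0 : (0 < e)%N.
  have [i _] := c_rep 1 (oner_neq0 L); exact: leq_ltn_trans (ltn_ord i).
have e0r : e%:R != 0 :> rat by rewrite pnatr_eq0 -lt0n.
have /fin_all_exists[s Es] i : exists s : int, c i * e%:R = s%:~R.
  by apply/intrP/e_kills.
have mod_lt (q : int) : (absz (q %% e)%Z < e)%N.
  by rewrite -ltz_nat gez0_abs ?modz_ge0 ?ltz_pmod // -lt0n.
pose g i : 'I_e := Ordinal (mod_lt (s i)).
have congr_val (x y : rat) (p q : int) : x * e%:R = p%:~R -> y * e%:R = q%:~R ->
    absz (p %% e)%Z = absz (q %% e)%Z -> exists k : int, x = y + k%:~R.
  move=> Ex Ey Epq; exists ((p %/ e)%Z - (q %/ e)%Z); apply: (mulIf e0r).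
  have Epq' : (p %% e)%Z = (q %% e)%Z.
    by rewrite -[LHS]gez0_abs ?Epq ?gez0_abs // modz_ge0 // -lt0n.
  have Epq2 : p = q + ((p %/ e)%Z - (q %/ e)%Z) * e%:Z.
    have := divz_eq p e; have := divz_eq q e; rewrite Epq' mulrBl.
    by move: (_ * _) (_ * _) => a b; lia.
  by rewrite mulrDl Ex Ey pmulrn -intrM -intrD -Epq2.
have g_inj : injective g.
  move=> i j /(congr1 val) /= gij.
  by have [k Ek] := congr_val _ _ _ _ (Es i) (Es j) gij; apply: rep_uniq Ek.
have [i /(congr1 val) /= Ei] := inj_surj_ord g_inj (Ordinal (mod_lt m)).
have [k Ek] := congr_val _ _ _ _ Em (Es i) (esym Ei).
have [x x0 wx] := c_val i; exists (x * (pi ^ k)%:A).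
  by rewrite mulf_neq0 // scaler_eq0 oner_eq0 orbF expfz_neq0 // (val_EFin_neq0 v_pi).
by rewrite val_mul wx w_ext (val_exprz _ v_pi) /= intz Ek.
Qed.

End Ramification.

Section GradedBasis.
Local Open Scope quotient_scope.
Variables (K : fieldType) (v : valuation int K) (L : fieldExtType K).
Local Notation A := (valRing v).
Local Notation "'va' a" := (er_map intr (v a) : \bar rat) (at level 10, a at level 8).

(** The family [y], indexed by [J], lifts a basis over the residue field of [v]
    of the graded piece [{u >= r} / {u > r}]; scalars of the residue field are
    represented by elements of [A], so no quotient module is formed. *)
Definition graded_basis (u : L -> \bar rat) (r : rat) (I : finType)
    (J : {pred I}) (y : I -> L) :=
  [/\ forall s, s \in J -> (r%:E <= u (y s))%E,
      forall x, (r%:E <= u x)%E -> exists c : I -> A,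
        (r%:E < u (x - \sum_(s in J) val (c s) *: y s)%R)%E
    & forall c : I -> A, (r%:E < u (\sum_(s in J) val (c s) *: y s)%R)%E ->
        forall s, s \in J -> c s \in maxideal v].

Section OneValuation.
Variables (w : valuation rat L) (w_ext : extends_val v w) (r : rat).

Lemma graded_basis_empty (J : pred 'I_0) (y : 'I_0 -> L) :
  (forall x, w x != r%:E%E) -> graded_basis w r J y.
Proof.
move=> wr; split=> [[]//|x rx|c _ []//]; exists (fun=> 0).
by rewrite big1 ?subr0; [rewrite lt_neqAle rx eq_sym wr|case].
Qed.

(** Multiplication by an element [x0] of value [r] identifies the residue field
    of [w] with the graded piece. *)
Lemma graded_basis_residue f x0 : residue_degree w_ext f -> w x0 = r%:E%E ->
  exists y : 'I_f -> L, graded_basis w r predT y.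
Proof.
case=> b b_basis wx0; have x00 := val_EFin_neq0 wx0.
have wVx0 := val_invr wx0.
exists (fun l => x0 * val (repr (b l))).
have lift (c : 'I_f -> A) :
    \pi_(resField w) (\sum_l valRing_incl w_ext (c l) * repr (b l)) =
    \sum_l resmap w_ext (\pi_(resField v) (c l)) * b l.
  rewrite rmorph_sum; apply: eq_bigr => l _.
  by rewrite rmorphM /= reprK resmap_pi.
have sumE (c : 'I_f -> A) : \sum_(l in predT) val (c l) *: (x0 * val (repr (b l))) =
    x0 * val (\sum_l valRing_incl w_ext (c l) * repr (b l)).
  rewrite rmorph_sum mulr_sumr; apply: eq_bigr => l _.
  by rewrite rmorphM /= mulr_algl scalerAr.
have scale y : (r%:E < w (x0 * y)%R)%E = (0 < w y)%E.
  by rewrite val_mul wx0 lteDl.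
split=> [l _|x rx|c]; first by rewrite val_mul wx0 leeDl //; exact: (valP (repr (b l))).
  have xO : x / x0 \in valring w.
    by rewrite inE val_mul wVx0 -[0%E]/((0:rat)%:E) -(subrr r) EFinD leeD2r.
  pose X := ValRing xO; have [c [Ec _]] := b_basis (\pi_(resField w) X).
  exists (fun l => repr (c 0 l)); rewrite sumE.
  have -> : x = x0 * val X by rewrite /= mulrCA mulfV // mulr1.
  rewrite -mulrBr scale -rmorphB.
  change (X - \sum_l valRing_incl w_ext (repr (c 0 l)) * repr (b l) \in maxideal w).
  rewrite -pi_res_eq0 rmorphB [X in _ - X]lift [X in X - _]Ec subr_eq0.
  by apply/eqP; apply: eq_bigr => l _; rewrite reprK.
rewrite sumE scale => c0 l _.
have {}c0 : \sum_l resmap w_ext (\pi_(resField v) (c l)) * b l = 0.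
  by rewrite -lift; apply/eqP; rewrite pi_res_eq0.
rewrite -pi_res_eq0; have [c' [_ c'_uniq]] := b_basis 0.
have E1 : c' = \row_j \pi_(resField v) (c j).
  by apply: c'_uniq; rewrite -[LHS]c0; apply: eq_bigr => j _; rewrite mxE.
have E0 : c' = 0.
  apply: c'_uniq; rewrite big1 // => j _; rewrite mxE.
  have -> : resmap w_ext 0 = 0.
    rewrite -(rmorph0 (\pi_(resField v))) resmap_pi.
    by apply/eqP; rewrite pi_res_eq0 /in_mem /= /maxideal /= scale0r val_zero.
  by rewrite mul0r.
by have /rowP/(_ l) := E1; rewrite E0 !mxE => <-.
Qed.

End OneValuation.

Section ManyValuations.
Variables (t : nat) (w : 'I_t -> valuation rat L).
Hypothesis w_ext : forall i, extends_val v (w i).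
Local Notation W := (minval w).

Lemma minval_valring_scale_gt (r : rat) (a : A) x :
  (r%:E < W x)%E -> (r%:E < W (val a *: x))%E.
Proof.
move=> rx; rewrite (minval_scale w_ext); apply: lt_le_trans rx _.
by rewrite leeDr //; have := valring_ge0 a; case: (v _) => //= k; rewrite !lee_fin ler0z.
Qed.

(** The two transition matrices, reduced to the residue field, have the identity
    as product. *)
Lemma graded_basis_card_le r (I I' : finType) (J : {pred I}) (J' : {pred I'}) y y' :
  graded_basis W r J y -> graded_basis W r J' y' -> (#|J| <= #|J'|)%N.
Proof.
case=> yr y_span y_ind [y'r y'_span _].
have /fin_all_exists[C EC] (i : 'I_#|J|) : exists c : I' -> A,
    (r%:E < W (y (enum_val i) - \sum_(s in J') val (c s) *: y' s)%R)%E.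
  by apply/y'_span/yr/enum_valP.
have /fin_all_exists[D ED] (j : 'I_#|J'|) : exists c : I -> A,
    (r%:E < W (y' (enum_val j) - \sum_(s in J) val (c s) *: y s)%R)%E.
  by apply/y_span/y'r/enum_valP.
pose M : 'M_(#|J|, #|J'|) := \matrix_(i, j) \pi_(resField v) (C i (enum_val j)).
pose N : 'M_(#|J'|, #|J|) := \matrix_(j, i) \pi_(resField v) (D j (enum_val i)).
suff MN : M *m N = 1%:M.
  rewrite -(mxrank1 (resField v) #|J|) -MN.
  exact: leq_trans (mxrankM_maxl _ _) (rank_leq_col _).
apply/matrixP => i k; rewrite !mxE.
pose c s : A := \sum_j C i (enum_val j) * D j s - (s == enum_val i)%:R.
have small : (r%:E < W (\sum_(s in J) val (c s) *: y s)%R)%E.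
  have -> : \sum_(s in J) val (c s) *: y s =
      - (y (enum_val i) - \sum_(s in J') val (C i s) *: y' s) +
      \sum_j val (C i (enum_val j)) *:
         - (y' (enum_val j) - \sum_(s in J) val (D j s) *: y s).
    under [X in _ = _ + X]eq_bigr => j _ do rewrite opprB scalerBr.
    rewrite sumrB opprB [in RHS]big_enum_val addrC addrA subrK.
    rewrite (eq_bigr (fun s => \sum_j val (C i (enum_val j)) *: (val (D j s) *: y s)
                       - (s == enum_val i)%:R *: y s)); last first.
      move=> s _; rewrite rmorphB rmorph_sum rmorph_nat scalerBl scaler_suml.
      by congr (_ - _); apply: eq_bigr => j _; rewrite rmorphM scalerA.
    rewrite sumrB exchange_big; congr (_ - _).
      by apply: eq_bigr => j _; rewrite scaler_sumr.
    rewrite (bigD1 (enum_val i)) ?enum_valP //= eqxx scale1r big1 ?addr0 //.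
    by move=> s /andP[_ /negPf ->]; rewrite scale0r.
  apply: lt_le_trans (minval_add _ _ _); rewrite lt_min minval_opp EC /=.
  by apply: minval_sum_gt => j _; apply: minval_valring_scale_gt; rewrite minval_opp.
have /(_ _ (enum_valP k)) := y_ind _ small.
rewrite -pi_res_eq0 rmorphB rmorph_sum subr_eq0 rmorph_nat (inj_eq enum_val_inj).
rewrite [k == i]eq_sym => /eqP <-.
by apply: eq_bigr => j _; rewrite !mxE rmorphM.
Qed.

Lemma graded_basis_card r (I I' : finType) (J : {pred I}) (J' : {pred I'}) y y' :
  graded_basis W r J y -> graded_basis W r J' y' -> #|J| = #|J'|.
Proof.
move=> Hy Hy'; apply/eqP; rewrite eqn_leq.
by rewrite (graded_basis_card_le Hy Hy') (graded_basis_card_le Hy' Hy).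
Qed.

Lemma reduced_graded n (b : 'I_n -> L) d r : \dim {:L} = n ->
  reduced_with v w b d -> (forall j, 0 <= d j < 1) -> 0 <= r < 1 ->
  graded_basis W r [pred j | d j == r] b.
Proof.
move=> dimL bd d01 r01; split=> [j /eqP dj|x rx|c].
- by rewrite (reduced_val bd) dj.
- have [a Ea] := reduced_span bd dimL x; rewrite Ea in rx.
  have {}rx j := reduced_geP bd _ _ rx j.
  have aA j : a j \in valring v.
    rewrite inE; apply: base_val_ge (rx j); have := d01 j; rewrite mulr0z; lra.
  exists (fun j => ValRing (aA j)).
  rewrite Ea (bigID [pred j | d j == r]) /= addrC addrK; apply: minval_sum_gt => j drj.
  rewrite (minval_scale w_ext) (reduced_val bd).
  have [rd|dr|/esym/eqP] := ltgtP r (d j); last by rewrite (negPf drj).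
    apply: (@lt_base_val _ _ 0); first by rewrite mulr0z add0r.
    by have := aA j; rewrite inE.
  apply: (@lt_base_val _ _ 1); first by have := d01 j; move: r01; rewrite mulr1z; lra.
  rewrite -base_val_gt0; have [->|a0] := eqVneq (a j) 0; first by rewrite val_zero ltry.
  have := rx j; have [k -> ->] := base_val v a0; rewrite -EFinD lee_fin lte_fin => H.
  rewrite -(ltr_int rat) mulr0z; lra.
- rewrite big_mkcond /=.
  under eq_bigr => i _ do
    rewrite -[X in if _ then _ else X](scale0r (b i)) -(fun_if (fun z => z *: b i)).
  move=> /(reduced_gtP bd) H j /eqP dj; rewrite /in_mem /= /maxideal.
  have := H j; rewrite inE dj eqxx; case: (v _) => [k| |] /=; rewrite ?ltry //.
  by rewrite -EFinD !lte_fin ltrDr ltr0z.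
Qed.

(** By approximation, bases of the graded pieces of the single valuations are
    realised simultaneously, each one being invisible to the other valuations. *)
Lemma graded_basis_glue (pi : K) (v_pi : v pi = 1%:E%E)
    (w_inj : forall i j, w i =1 w j -> i = j) r (D : 'I_t -> nat)
    (y : forall i, 'I_(D i) -> L) :
  (forall i, graded_basis (w i) r predT (y i)) ->
  exists Y : {i & 'I_(D i)} -> L, graded_basis W r predT Y.
Proof.
move=> y_basis; pose tg i (l : 'I_(D i)) := Tagged (fun i => 'I_(D i)) l.
have /fin_all_exists[Y /all_and2[Y1 Y2]] (s : {i & 'I_(D i)}) : exists z,
    (r%:E < w (tag s) (z - y (tag s) (tagged s))%R)%E /\
    forall j, j != tag s -> (r%:E < w j z)%E.
  exact: (approximation v_pi w_ext w_inj).
have near (c : {i & 'I_(D i)} -> A) i :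
    (r%:E < w i (\sum_s val (c s) *: Y s
                 - \sum_l val (c (tg i l)) *: y i l)%R)%E.
  have -> : \sum_s val (c s) *: Y s =
      \sum_j \sum_l val (c (tg j l)) *: Y (tg j l).
    by rewrite sig_big_dep /=; apply: eq_bigr => -[].
  rewrite (bigD1 i) //= addrAC -sumrB.
  have scale (a : A) x : (r%:E < w i x)%E -> (r%:E < w i (val a *: x))%E.
    move=> rx; rewrite (ext_scale w_ext); apply: lt_le_trans rx _.
    rewrite leeDr //; have := valring_ge0 a.
    by case: (v _) => //= k; rewrite !lee_fin ler0z.
  apply: lt_le_trans (val_add (w i) _ _); rewrite lt_min; apply/andP; split.
    by apply: val_sum_gt => l _; rewrite -scalerBr scale // (Y1 (tg i l)).
  apply: val_sum_gt => j ji; apply: val_sum_gt => l _; apply: scale.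
  by apply: Y2; rewrite eq_sym.
have wB i x x' : (r%:E < w i (x' - x)%R)%E -> (r%:E < w i x)%E -> (r%:E < w i x')%E.
  move=> H1 H2; rewrite -(subrK x x'); apply: lt_le_trans (val_add _ _ _).
  by rewrite lt_min H1.
exists Y; split=> [s _|x /minval_geP rx|c /minval_gtP rc].
- apply/minval_geP => j; have [->|js] := eqVneq j (tag s); last exact/ltW/Y2.
  rewrite -(subrK (y (tag s) (tagged s)) (Y s)).
  apply: le_trans (val_add _ _ _); rewrite le_min ltW //=.
  by have [H _ _] := y_basis (tag s); apply: H.
- have /fin_all_exists[c Ec] i : exists c : 'I_(D i) -> A,
      (r%:E < w i (x - \sum_l val (c l) *: y i l)%R)%E.
    by have [_ H _] := y_basis i; apply: H.
  exists (fun s => c (tag s) (tagged s)); apply/minval_gtP => i.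
  apply: (wB _ _ _ _ (Ec i)); rewrite opprB addrC addrA subrK -opprB val_opp.
  exact: near.
- move=> [i l] _; have [_ _ H] := y_basis i.
  apply: (H (fun l => c (tg i l))) => //.
  by apply: (wB _ _ _ _ (rc i)); rewrite -opprB val_opp; apply: near.
Qed.

Lemma reduced_value_count (pi : K) (v_pi : v pi = 1%:E%E)
    (w_inj : forall i j, w i =1 w j -> i = j) (e f : 'I_t -> nat)
    (e_ram : forall i, ramification_index v (w i) (e i))
    (f_res : forall i, residue_degree (w_ext i) (f i))
    n (b : 'I_n -> L) d r : \dim {:L} = n ->
  reduced_with v w b d -> (forall j, 0 <= d j < 1) -> 0 <= r < 1 ->
  #|[pred j | d j == r]| = W_mult e f r.
Proof.
move=> dimL bd d01 r01.
pose D i := if r * (e i)%:R \is a Num.int then f i else 0%N.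
have y_ex i : exists y : 'I_(D i) -> L, graded_basis (w i) r predT y.
  have := ramification_value v_pi (w_ext i) r (e_ram i); rewrite /D.
  case: ifP => rZ [H1 H2].
    have [x0 _ wx0] := H1 isT.
    exact: graded_basis_residue (f_res i) wx0.
  exists (fun=> 0); apply: graded_basis_empty => x; apply/negP => /eqP wx.
  have : false by apply: H2; exists x; rewrite ?(val_EFin_neq0 wx).
  by [].
pose y i := projT1 (cid (y_ex i)).
have [Y Y_basis] := graded_basis_glue v_pi w_inj (fun i => projT2 (cid (y_ex i))).
rewrite (graded_basis_card (reduced_graded dimL bd d01 r01) Y_basis).
rewrite card_tagged sumnE big_map big_enum /W_mult [RHS]big_mkcond /=.
by apply: eq_bigr => i _; rewrite card_ord.
Qed.

End ManyValuations.

End GradedBasis.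

(** * Block matrices over the valuation ring *)

Lemma card_map_enum (T : eqType) n (d : 'I_n -> T) x :
  count_mem x [seq d j | j <- enum 'I_n] = #|[pred j | d j == x]|.
Proof. by rewrite count_map cardE -size_filter enumT. Qed.

Lemma sorted_map_enum n (d : 'I_n -> rat) :
  (forall i j : 'I_n, (i <= j)%N -> d i <= d j) -> sorted <=%R [seq d j | j <- enum 'I_n].
Proof.
move=> d_mono; rewrite sorted_map.
apply: (@sub_sorted _ (relpre val leq)) => [i j /=|]; first exact: d_mono.
by rewrite -sorted_map val_enum_ord iota_sorted.
Qed.

Lemma nondecreasing_unique n (d d' : 'I_n -> rat) :
  (forall i j : 'I_n, (i <= j)%N -> d i <= d j) ->
  (forall i j : 'I_n, (i <= j)%N -> d' i <= d' j) ->
  (forall r, #|[pred j | d j == r]| = #|[pred j | d' j == r]|) -> d =1 d'.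
Proof.
move=> d_mono d'_mono dd'.
have : [seq d j | j <- enum 'I_n] = [seq d' j | j <- enum 'I_n].
  apply: (sorted_eq le_trans le_anti); [exact: sorted_map_enum..|].
  by apply/allP => r _; rewrite /= !card_map_enum dd'.
by move/eq_in_map => E j; apply: E; rewrite mem_enum.
Qed.

Section Blocks.
Variables (kappa : nat) (m : 'I_kappa -> nat).
Local Notation N := (\sum_i m i)%N.

Lemma big_Rank (R : Type) (idx : R) (op : Monoid.com_law idx) (F : 'I_N -> R) :
  \big[op/idx]_s F s = \big[op/idx]_i \big[op/idx]_(p < m i) F (tagnat.Rank i p).
Proof.
rewrite sig_big_dep (reindex _ tagnat.sig_bij_on) /=.
by apply: eq_bigr => s _; rewrite -tagnat.rankE tagnat.sigK.
Qed.

Lemma card_sig1 i : #|[pred s : 'I_N | tagnat.sig1 s == i]| = m i.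
Proof.
rewrite -sum1_card big_mkcond [LHS]big_Rank (bigD1 i) //= [X in (_ + X)%N]big1.
  rewrite addn0 (eq_bigr (fun=> 1%N)) ?sum1_card ?card_ord // => p _.
  by rewrite inE tagnat.Rank1K eqxx.
move=> j /negPf ji; rewrite big1 // => p _.
by rewrite inE tagnat.Rank1K ji.
Qed.

Variables (eps : 'I_kappa -> rat).
Hypothesis eps_incr : forall i j : 'I_kappa, (i < j)%N -> eps i < eps j.

Lemma eps_le (i j : 'I_kappa) : (i <= j)%N -> eps i <= eps j.
Proof. by rewrite leq_eqVlt => /predU1P[/val_inj->//|/eps_incr/ltW]. Qed.

Lemma eps_inj : injective eps.
Proof.
move=> i j eij; have [/eps_incr|/eps_incr|/val_inj//] := ltngtP i j;
  by rewrite eij ltxx.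
Qed.

Lemma values_card n (d : 'I_n -> rat) : (forall j, exists i, eps i = d j) ->
  (forall i, #|[pred j | d j == eps i]| = m i) -> N = n.
Proof.
move=> d_eps dm; rewrite -[RHS]card_ord -sum1_card.
rewrite (eq_bigr (fun i => \sum_(j | d j == eps i) 1)%N); last first.
  by move=> i _; rewrite sum1_card dm.
rewrite (exchange_big_dep predT) //=; apply: eq_bigr => j _.
have [i Ei] := d_eps j; rewrite (eq_bigl (pred1 i)) ?big_pred1_eq // => k /=.
by rewrite -Ei (inj_eq eps_inj) eq_sym.
Qed.

Lemma values_block (d : 'I_N -> rat) :
  (forall i j : 'I_N, (i <= j)%N -> d i <= d j) ->
  (forall j, exists i, eps i = d j) ->
  (forall i, #|[pred j | d j == eps i]| = m i) ->
  d =1 eps \o tagnat.sig1.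
Proof.
move=> d_mono d_eps dm; apply: nondecreasing_unique => // [i j ij|r].
  by apply: eps_le; apply: (tagnat.le_sig1 (p_ := m)).
have [[i <-]|no_i] := pselect (exists i, eps i = r).
  rewrite dm -(card_sig1 i); apply: eq_card => s.
  by rewrite !inE /= (inj_eq eps_inj).
rewrite !eq_card0 // => j; rewrite inE; apply/negP => /eqP Ej; apply: no_i.
  by exists (tagnat.sig1 j).
by have [i Ei] := d_eps j; exists i; rewrite Ei.
Qed.

Section OverValuationRing.
Variables (K : fieldType) (v : valuation int K) (L : fieldExtType K).
Local Notation A := (valRing v).
Local Notation "'va' a" := (er_map intr (v a) : \bar rat) (at level 10, a at level 8).

(** [A] is local, so invertibility is tested on the determinant in the residue
    field. *)
Lemma unitmx_mod_maxideal k (M : 'M[A]_k) :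
  (forall p q, M p q - (p == q)%:R \in maxideal v) -> M \in unitmx.
Proof.
move=> M1; rewrite unitmxE -[_ \is a _]negbK -maxidealE -pi_res_eq0.
have -> : (\pi_(resField v) (\det M))%qT = 1; last exact: oner_neq0.
rewrite -det_map_mx -[RHS](det1 _ k); congr (\det _); apply/matrixP => p q.
rewrite !mxE; have := M1 p q.
by rewrite -pi_res_eq0 rmorphB rmorph_nat subr_eq0 => /eqP.
Qed.

Definition block_triangular (T : 'M[A]_N) :=
  forall s p, (tagnat.sig1 p < tagnat.sig1 s)%N -> T s p \in maxideal v.

(** Modulo the maximal ideal, [S] and [T] are block upper triangular, so their
    diagonal blocks multiply to identity matrices. *)
Lemma block_triangular_unit (S T : 'M[A]_N) : block_triangular S ->
  block_triangular T -> S *m T = 1%:M ->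
  forall i, submxblock T i i \in unitmx.
Proof.
move=> S_tri T_tri ST i.
suff : submxblock S i i *m submxblock T i i \in unitmx.
  by rewrite unitmx_mul => /andP[].
apply: unitmx_mod_maxideal => p q.
have /matrixP/(_ (tagnat.Rank i p) (tagnat.Rank i q)) := ST.
rewrite !mxE big_Rank (bigD1 i) //= => STpq.
have -> : (p == q) = (tagnat.Rank i p == tagnat.Rank i q :> 'I_N).
  by rewrite -[RHS]val_eqE tagnat.eq_Rank eqxx.
rewrite -STpq opprD addrA.
rewrite (eq_bigr (fun l => S (tagnat.Rank i p) (tagnat.Rank i l) *
                           T (tagnat.Rank i l) (tagnat.Rank i q))); last first.
  by move=> l _; rewrite !mxE.
rewrite subrr sub0r rpredN; apply: rpred_sum => j ji; apply: rpred_sum => l _.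
have [lt_ij|lt_ji|/val_inj Eij] := ltngtP i j; last by rewrite Eij eqxx in ji.
  by rewrite idealMr // T_tri // !tagnat.Rank1K.
by rewrite mulrC idealMr // S_tri // !tagnat.Rank1K.
Qed.

End OverValuationRing.
End Blocks.

(** * Transition matrices between reduced bases *)

Section Transition.
Variables (kappa : nat) (m : 'I_kappa -> nat) (eps : 'I_kappa -> rat).
Hypothesis eps_incr : forall i j : 'I_kappa, (i < j)%N -> eps i < eps j.
Hypothesis eps01 : forall i, 0 <= eps i < 1.
Local Notation N := (\sum_i m i)%N.
Variables (K : fieldType) (v : valuation int K) (L : fieldExtType K).
Variables (t : nat) (w : 'I_t -> valuation rat L).
Hypothesis w_ext : forall i, extends_val v (w i).
Local Notation A := (valRing v).
Local Notation W := (minval w).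
Local Notation "'va' a" := (er_map intr (v a) : \bar rat) (at level 10, a at level 8).
Local Notation Rk := (tagnat.Rank (p_ := m)).

Variable b : 'I_N -> L.
Hypothesis b_red : reduced_with v w b (eps \o tagnat.sig1).

Lemma transition_entries (T : 'I_N -> 'I_N -> K) (b' : 'I_N -> L) :
  (forall s, b' s = \sum_p T s p *: b p) ->
  (forall s, W (b' s) = (eps (tagnat.sig1 s))%:E%E) ->
  (forall s p, T s p \in valring v) /\
  (forall s p, (tagnat.sig1 p < tagnat.sig1 s)%N -> (0 < v (T s p))%E).
Proof.
move=> Eb' Wb'.
have entry s p : ((eps (tagnat.sig1 s))%:E <= va (T s p) + (eps (tagnat.sig1 p))%:E)%E.
  have : ((eps (tagnat.sig1 s))%:E <= W (b' s))%E by rewrite Wb'.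
  by rewrite Eb' => /(reduced_geP b_red)/(_ p).
split=> s p => [|lt_ps].
  rewrite inE; apply: base_val_ge (entry s p).
  have := eps01 (tagnat.sig1 s); have := eps01 (tagnat.sig1 p); rewrite mulr0z; lra.
rewrite base_val_gt0; apply: base_val_ge (entry s p).
by have := eps_incr lt_ps; rewrite mulr1z; lra.
Qed.

Lemma transition_block_triangular (T : 'I_N -> 'I_N -> K) (b' : 'I_N -> L) :
  reduced_with v w b' (eps \o tagnat.sig1) ->
  (forall s, b' s = \sum_p T s p *: b p) ->
  exists T0 : 'M[A]_N, (forall s p, val (T0 s p) = T s p) /\ block_triangular T0.
Proof.
move=> b'_red Eb'; have [TA Tm] := transition_entries Eb' (reduced_val b'_red).
exists (\matrix_(s, p) ValRing (TA s p)); split=> [s p|s p lt_ps]; rewrite mxE //.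
exact: Tm.
Qed.

Section Backward.
Variable T : 'M[A]_N.
Hypothesis T_unit : forall i, submxblock T i i \in unitmx.
Hypothesis T_tri : block_triangular T.
Let b' s := \sum_p val (T s p) *: b p.

(** Strictly smaller values may occur in earlier blocks, but their coefficients
    lie in the maximal ideal, which raises the value by at least 1. *)
Lemma block_triangular_val_ge s : ((eps (tagnat.sig1 s))%:E <= W (b' s))%E.
Proof.
apply/(reduced_geP b_red) => p /=.
have [lt_ps|le_sp] := ltnP (tagnat.sig1 p) (tagnat.sig1 s).
  apply: (@le_base_val _ _ 1); last by rewrite -base_val_gt0; apply: T_tri.
  have := eps01 (tagnat.sig1 s); have := eps01 (tagnat.sig1 p); rewrite mulr1z; lra.
apply: (@le_base_val _ _ 0); last exact: valring_ge0.
by rewrite mulr0z add0r; apply: eps_le le_sp.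
Qed.

(** [a] is recovered from [c] by the inverse of the block, whose entries are in
    [A]. *)
Lemma unit_block_kernel i (k : int) (a c : 'I_(m i) -> K) :
  (forall p, c p = \sum_l a l * val (T (Rk i l) (Rk i p))) ->
  (forall p, (k%:E <= v (c p))%E) -> forall l, (k%:E <= v (a l))%E.
Proof.
move=> Ec kc l; pose U := invmx (submxblock T i i).
have TU q : \sum_p val (T (Rk i q) (Rk i p)) * val (U p l) = (q == l)%:R.
  have /matrixP/(_ q l) := mulmxV (T_unit i).
  rewrite !mxE => /(congr1 val); rewrite rmorph_sum rmorph_nat => <-.
  by apply: eq_bigr => p _; rewrite !mxE rmorphM.
have -> : a l = \sum_p c p * val (U p l).
  under eq_bigr do rewrite Ec mulr_suml.
  rewrite exchange_big (bigD1 l) //= [X in _ + X]big1 ?addr0 => [|q /negPf ql].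
    by under eq_bigr do rewrite -mulrA; rewrite -mulr_sumr TU eqxx mulr1.
  by under eq_bigr do rewrite -mulrA; rewrite -mulr_sumr TU ql mulr0.
apply: val_sum_ge => p _; rewrite val_mul; apply: le_trans (kc p) _.
by rewrite leeDl // valring_ge0.
Qed.

(** The nontrivial inequality compares, in the block [i] of an index at which the
    minimum [k + eps i] is reached, the coefficients of the sum with those of
    [a]: terms from later blocks gain 1 from [T], and in earlier blocks [a]
    itself has value at least [k + 1] because [eps] is smaller there. *)
Lemma block_triangular_reduced : reduced_with v w b' (eps \o tagnat.sig1).
Proof.
move=> a; apply: le_anti; apply/andP; split; last first.
  apply: minval_sum_ge => s _; rewrite (minval_scale w_ext).
  by apply: le_trans (bigmin_le _ s _) _; rewrite leeD2l // block_triangular_val_ge.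
pose c p := \sum_s a s * val (T s p).
have -> : \sum_s a s *: b' s = \sum_p c p *: b p.
  rewrite (eq_bigr (fun s => \sum_p (a s * val (T s p)) *: b p)); last first.
    by move=> s _; rewrite scaler_sumr; apply: eq_bigr => p _; rewrite scalerA.
  by rewrite [LHS]exchange_big; apply: eq_bigr => p _; rewrite scaler_suml.
rewrite leNgt; apply/negP => lt_min.
pose g s := (va (a s) + (eps (tagnat.sig1 s))%:E)%E.
have [s0 _ Es0] : exists2 s0, true & \big[Order.min/+oo%E]_s g s = g s0.
  case: (pickP (fun s : 'I_N => true)) => [s _|no_s].
    have [|s0 _ Es0] := @eq_bigmin _ _ _ +oo%E s predT g isT.
      by move=> *; rewrite leey.
    by exists s0.
  by move: lt_min; rewrite [X in (X < _)%E]big_pred0 // ltNge leey.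
rewrite -[X in (X < _)%E]/(\big[Order.min/+oo%E]_s g s) Es0 /g in lt_min.
rewrite /g in Es0.
have a0 : a s0 != 0.
  by apply: contraTneq lt_min => ->; rewrite base_val0 addye // ltNge leey.
have [k vk Ek] := base_val v a0; set i := tagnat.sig1 s0 in Es0 lt_min.
rewrite Ek -EFinD in Es0 lt_min.
have a_ge s : ((k%:~R + eps i)%:E <= va (a s) + (eps (tagnat.sig1 s))%:E)%E.
  by rewrite -Es0; apply: bigmin_le.
have c_gt p : ((k%:~R + eps i)%:E < va (c p) + (eps (tagnat.sig1 p))%:E)%E.
  by have /(reduced_gtP b_red) := lt_min.
have off_block (s : 'I_N) p : tagnat.sig1 p = i -> tagnat.sig1 s != i ->
    ((k + 1)%:E <= v (a s * val (T s p))%R)%E.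
  move=> pi; rewrite val_mul; have := eps01 i; have := eps01 (tagnat.sig1 s) => e1 e2.
  have [lt_si _|lt_is _|/val_inj ->] := ltngtP (tagnat.sig1 s) i; last by rewrite eqxx.
    apply: le_trans (leeDl _ (valring_ge0 (T s p))); apply: base_val_ge (a_ge s).
    by have := eps_incr lt_si; rewrite intrD; lra.
  rewrite EFinD; apply: leeD; last first.
    by rewrite -base_val_gt0; apply: T_tri; rewrite pi.
  by apply: base_val_ge (a_ge s); lra.
pose c' p := \sum_(l < m i) a (Rk i l) * val (T (Rk i l) (Rk i p)).
have c'_ge p : ((k + 1)%:E <= v (c' p))%E.
  have -> : c' p = c (Rk i p) -
      \sum_(j | j != i) \sum_(l < m j) a (Rk j l) * val (T (Rk j l) (Rk i p)).
    by rewrite /c big_Rank (bigD1 i) //= addrK.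
  apply: le_trans (val_add _ _ _); rewrite le_min val_opp; apply/andP; split.
    by apply: base_val_gt (c_gt _); rewrite tagnat.Rank1K intrD; lra.
  apply: val_sum_ge => j ji; apply: val_sum_ge => l _.
  by apply: off_block; rewrite tagnat.Rank1K.
have := unit_block_kernel (fun p => erefl (c' p)) c'_ge (tagnat.sig2 s0).
by rewrite tagnat.sig2K vk lee_fin gerDl.
Qed.

End Backward.
End Transition.

Theorem theorem2p11
  (K : fieldType) (v : valuation int K)
  (v_normalized : exists pi : K, v pi = 1%:E%E)
  (L : fieldExtType K) (n : nat) (n_gt1 : (1 < n)%N)
  (dimL : \dim {:L} = n)
  (theta : L) (g : {poly K})
  (g_A : g \is a polyOver (valring v)) (g_monic : g \is monic)
  (g_irr : irreducible_poly g) (g_deg : size g = n.+1)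
  (g_theta : root (map_poly (in_alg L) g) theta)
  (L_theta : <<1; theta>>%VS = {:L}%VS)
  (B_fg : fg_int_closure v L)
  (t : nat) (w : 'I_t -> valuation rat L)
  (w_all : all_extensions v w)
  (w_ext : forall i, extends_val v (w i))
  (e f : 'I_t -> nat)
  (e_ram : forall i, ramification_index v (w i) (e i))
  (f_res : forall i, residue_degree (w_ext i) (f i))
  (kappa : nat) (eps : 'I_kappa -> rat)
  (eps_0 : forall i : 'I_kappa, i = 0%N :> nat -> eps i = 0)
  (eps_incr : forall i j : 'I_kappa, (i < j)%N -> eps i < eps j)
  (eps_W : forall delta, W_support w delta <-> exists i, eps i = delta)
  (alpha : 'cV[L]_n) (alpha_orth : orthonormal_basis v w alpha)
  (alpha' : 'cV[L]_n) (T : 'M[K]_n)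
  (alpha'_T : alpha' = map_mx (in_alg L) T *m alpha) :
  orthonormal_basis v w alpha' <->
  in_orthonormal_group v (fun i => W_mult e f (eps i)) T.
Proof.
have [pi v_pi] := v_normalized.
have n0 : (0 < n)%N by apply: ltnW.
have [_ w_inj w_cov] := w_all.
have t0 : (0 < t)%N.
  have [u /w_cov[i _]] := exists_extension L v_pi; exact: leq_ltn_trans (ltn_ord i).
have eps01 i : 0 <= eps i < 1 by have [] : W_support w (eps i) by apply/eps_W; exists i.
pose m i := W_mult e f (eps i); rewrite -/m.
have values (beta : 'cV[L]_n) d : reduced_with v w (fun j => beta j 0) d ->
    integral_basis v beta ->
  [/\ forall j, 0 <= d j < 1, forall j, exists i, eps i = d j &
      forall i, #|[pred j | d j == eps i]| = m i].
  move=> bd /(reduced_integral_basis v_pi w_ext n0 dimL bd (fun=> erefl)) d01.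
  split=> // [j|i].
    apply/eps_W; split=> //; exists (beta j 0); last exact: reduced_val bd j.
    by have [/(_ j)] := reduced_withP w_ext bd.
  exact: (reduced_value_count v_pi w_inj e_ram f_res dimL bd d01 (eps01 i)).
have [alpha_red alpha_int alpha_mono] := alpha_orth.
have [d bd] := reducedP w_ext t0 alpha_red.
have [d01 d_eps dm] := values _ _ bd alpha_int.
have Nn := values_card eps_incr d_eps dm.
have d_mono (beta : 'cV[L]_n) d1 : reduced_with v w (fun j => beta j 0) d1 ->
    (forall i j : 'I_n, (i <= j)%N ->
       (minval w (beta i 0%R) <= minval w (beta j 0%R))%E) ->
    forall i j : 'I_n, (i <= j)%N -> d1 i <= d1 j.
  move=> b1 mono i j /mono.
  by have := reduced_val b1 i; have := reduced_val b1 j => /= -> ->.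
move: dimL; subst n => dimL.
have in_groupE : in_orthonormal_group v m T <->
    exists T0 : 'M[valRing v]_(\sum_i m i), T = map_mx val T0 /\ orthonormal_group T0.
  split=> [[mn [T0 [ET OT]]]|[T0 [ET OT]]]; first by exists T0; rewrite castmx_id in ET.
  by exists erefl, T0; rewrite castmx_id.
have block_values (beta : 'cV[L]_(\sum_i m i)) : orthonormal_basis v w beta ->
    reduced_with v w (fun j => beta j 0) (eps \o tagnat.sig1).
  move=> [beta_red beta_int beta_mono].
  have [d1 b1] := reducedP w_ext t0 beta_red.
  have [_ d1_eps d1m] := values _ _ b1 beta_int.
  have E := values_block eps_incr (d_mono _ _ b1 beta_mono) d1_eps d1m.
  by move=> a; rewrite b1; apply: eq_bigr => j _; rewrite E.
have {bd}b_red := block_values _ alpha_orth.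
have Ealpha' s : alpha' s 0 = \sum_p T s p *: alpha p 0.
  by rewrite alpha'_T mxE; apply: eq_bigr => p _; rewrite mxE mulr_algl.
apply: (iff_trans _ (iff_sym in_groupE)).
split=> [alpha'_orth|[T0 [ET [T0_unit T0_tri]]]].
  have b'_red := block_values _ alpha'_orth.
  have /fin_all_exists[S ES] p : exists a, alpha p 0 = \sum_s a s *: alpha' s 0.
    exact: reduced_span b'_red dimL _.
  have [T0 [ET0 T0_tri]] :=
    transition_block_triangular eps_incr eps01 b_red b'_red Ealpha'.
  have [S0 [ES0 S0_tri]] :=
    transition_block_triangular eps_incr eps01 b'_red b_red ES.
  have ST : S0 *m T0 = 1%:M.
    apply/matrixP => p q; apply: val_inj.
    rewrite !mxE rmorph_sum rmorph_nat.
    apply: (reduced_inj b_red (a := fun q => \sum_s val (S0 p s * T0 s q))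
              (a' := fun q => (p == q)%:R)).
    rewrite [RHS](bigD1 p) //= eqxx scale1r [X in _ = _ + X]big1 ?addr0; last first.
      by move=> i; rewrite eq_sym => /negPf ->; rewrite scale0r.
    rewrite ES (eq_bigr (fun i => \sum_s (S p s * T s i) *: alpha i 0)); last first.
      by move=> i _; rewrite scaler_suml; apply: eq_bigr => s _; rewrite -ES0 -ET0.
    rewrite [LHS]exchange_big; apply: eq_bigr => s _.
    by rewrite Ealpha' scaler_sumr; apply: eq_bigr => i _; rewrite scalerA.
  exists T0; split; first by apply/matrixP => s p; rewrite mxE ET0.
  split; first exact: block_triangular_unit S0_tri T0_tri ST.
  by move=> i j ij p q; rewrite mxE T0_tri // !tagnat.Rank1K.
have {}T0_tri : block_triangular T0.
  by move=> s p lt_ps; have := T0_tri _ _ lt_ps (tagnat.sig2 s) (tagnat.sig2 p);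
    rewrite mxE !tagnat.sig2K.
have b'_red : reduced_with v w (fun j => alpha' j 0) (eps \o tagnat.sig1).
  have -> : (fun j => alpha' j 0) = fun s => \sum_p val (T0 s p) *: alpha p 0.
    by apply/funext => s; rewrite Ealpha' ET; apply: eq_bigr => p _; rewrite mxE.
  exact: (block_triangular_reduced eps_incr eps01 w_ext b_red T0_unit T0_tri).
split.
- apply: (reduced_withP (alpha:=alpha') w_ext b'_red).
- apply/(reduced_integral_basis v_pi w_ext n0 dimL b'_red (fun=> erefl)) => j.
  exact: eps01.
- move=> i j ij; have := reduced_val b'_red i; have := reduced_val b'_red j => /= -> ->.
  by rewrite lee_fin; apply: (eps_le eps_incr); apply: (tagnat.le_sig1 (p_ := m)).
Qed.
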